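(* Let $\Sigma_0$ be a closed minimal Lagrangian torus in $\mathbb{C}P^2$, and let $\Sigma_t$ be a smooth deformation of $\Sigma_0$ preserving the conformal type of $\Sigma_0$ and such that each $\Sigma_t$ is still minimal Lagrangian. Then the area is preserved: $$\mathrm{Area}(\Sigma_t)=\mathrm{Area}(\Sigma_0)\quad\text{for all } t.$$
   Context: $\mathbb{C}P^2$ carries the Fubini–Study metric for which the Hopf projection $S^5\to\mathbb{C}P^2$ from the unit sphere $S^5\subset\mathbb{C}^3$ is a Riemannian submersion. Tori are immersed. A smooth deformation $\Sigma_t$ of $\Sigma_0$ is a smooth one-parameter family ($t$ in an interval containing $0$) of immersions of the torus into $\mathbb{C}P^2$ starting at $\Sigma_0$; it preserves the conformal type if for every $t$ the torus with the metric induced by $\Sigma_t$ is conformally equivalent to the torus with the metric induced by $\Sigma_0$. $\mathrm{Area}$ is the area in the induced metric. *)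

(* Defs.v *)
From HB Require Import structures.
From mathcomp Require Import all_boot all_order all_algebra generic_quotient.
From mathcomp Require Import complex.
From mathcomp Require Import ring.
From mathcomp Require Import all_classical all_reals all_analysis.

Set Implicit Arguments.
Unset Strict Implicit.
Unset Printing Implicit Defensive.

Import Order.TTheory GRing.Theory Num.Theory.
Import numFieldNormedType.Exports.

Local Open Scope quotient_scope.
Local Open Scope classical_set_scope.
Local Open Scope complex_scope.
Local Open Scope ring_scope.

Section Smooth.
Context {R : realType} {V W : normedModType R}.

(* C^k, on an open set of a finite-dimensional V: the derivative being C^k   *)
(* is expressed by all directional derivatives being C^k.                    *)
Fixpoint differentiable_times (k : nat) (U : set V) (f : V -> W) : Prop :=
  if k is k'.+1 then
    (forall x, U x -> differentiable f x) /\
    (forall v, differentiable_times k' U ('D_v f))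
  else forall x, U x -> {for x, continuous f}.

Definition smooth (U : set V) (f : V -> W) : Prop :=
  open U /\ forall k, differentiable_times k U f.

End Smooth.

(* Submanifold geometry inside one coordinate chart with values in R^n:      *)
(* G p is the Gram matrix at p of a Riemannian metric in the coordinate      *)
(* frame, and u : R^m -> R^n parametrizes an m-dimensional submanifold.      *)
(* Vectors are rows.                                                         *)
Section ChartGeometry.
Context {R : realType}.

Definition pd (n : nat) (W : normedModType R) (i : 'I_n)
    (f : 'rV[R]_n -> W) : 'rV[R]_n -> W := 'D_(delta_mx 0 i) f.

Context {m n : nat}.
Implicit Types (G : 'rV[R]_n -> 'M[R]_n) (u : 'rV[R]_m -> 'rV[R]_n).

(* Row i is the coordinate tangent vector d_i u. *)
Definition jac u (x : 'rV[R]_m) : 'M[R]_(m, n) :=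
  \matrix_(i, a) pd i u x 0 a.

(* u^*B for a field B of bilinear forms. *)
Definition pullback (B : 'rV[R]_n -> 'M[R]_n) u (x : 'rV[R]_m) : 'M[R]_m :=
  jac u x *m B (u x) *m (jac u x)^T.

(* Gamma^c_{ab} of the Levi-Civita connection of G. *)
Definition christoffel G (p : 'rV[R]_n) (c a b : 'I_n) : R :=
  2^-1 * \sum_d invmx (G p) c d *
    (pd a (fun q => G q d b) p + pd b (fun q => G q a d) p
     - pd d (fun q => G q a b) p).

(* nabla_{d_i u} (d_j u), for the Levi-Civita connection of G. *)
Definition covd G u (i j : 'I_m) (x : 'rV[R]_m) : 'rV[R]_n :=
  \row_c (pd i (pd j u) x 0 c +
    \sum_a \sum_b christoffel G (u x) c a b * jac u x i a * jac u x j b).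

(* The G-orthogonal projection of v to the span of the d_i u. *)
Definition tangent_part G u (x : 'rV[R]_m) (v : 'rV[R]_n) : 'rV[R]_n :=
  v *m G (u x) *m (jac u x)^T *m invmx (pullback G u x) *m jac u x.

Definition second_fundamental_form G u (i j : 'I_m) (x : 'rV[R]_m) :
    'rV[R]_n :=
  covd G u i j x - tangent_part G u x (covd G u i j x).

(* Trace of the second fundamental form (not divided by m). *)
Definition mean_curvature G u (x : 'rV[R]_m) : 'rV[R]_n :=
  \sum_i \sum_j invmx (pullback G u x) i j *: second_fundamental_form G u i j x.

End ChartGeometry.

Section ProjectivePlane.
Context {R : realType}.
Local Notation C := R[i].

Definition herm (n : nat) (v w : 'rV[C]_n) : C := \sum_j v 0 j * (w 0 j)^*.

Definition in_S5 (z : 'rV[C]_3) : bool := herm z z == 1.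
Local Notation S5 := {z : 'rV[C]_3 | in_S5 z}.

Definition same_fibre (z w : S5) : bool :=
  `[< exists c : C, `|c| = 1 /\ val w = c *: val z >].

Lemma same_fibre_refl : reflexive same_fibre.
Proof. by move=> z; apply/asboolP; exists 1; rewrite normr1 scale1r. Qed.

Lemma same_fibre_sym : symmetric same_fibre.
Proof.
have H z w : same_fibre z w -> same_fibre w z.
  move=> /asboolP[c [c1 e]]; apply/asboolP; exists c^-1.
  rewrite normfV c1 invr1 e scalerA mulVf ?scale1r//.
  by rewrite -normr_eq0 c1 oner_eq0.
by move=> z w; apply/idP/idP => /H.
Qed.

Lemma same_fibre_trans : transitive same_fibre.
Proof.
move=> y x z /asboolP[c [c1 e]] /asboolP[d [d1 e']]; apply/asboolP.
by exists (d * c); rewrite normrM c1 d1 mulr1 e' e scalerA.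
Qed.

Canonical same_fibre_equiv :=
  EquivRel same_fibre same_fibre_refl same_fibre_sym same_fibre_trans.

Definition CP2 : Type := {eq_quot same_fibre_equiv}.

Definition hopf (z : S5) : CP2 := \pi_({eq_quot same_fibre_equiv}) z.

(* Homogeneous coordinates of p, of norm 1. *)
Definition rep (p : CP2) : 'rV[C]_3 :=
  val (repr (p : {eq_quot same_fibre_equiv})).

Lemma rep_hopf z : exists2 c : C, c != 0 & rep (hopf z) = c *: val z.
Proof.
rewrite /rep /hopf.
have : same_fibre z (repr (\pi_({eq_quot same_fibre_equiv}) z)).
  by rewrite -[same_fibre _ _]/(same_fibre_equiv _ _) -eqmodE reprK.
move=> /asboolP[c [c1 ->]]; exists c => //.
by rewrite -normr_eq0 c1 oner_eq0.
Qed.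

(* R^4 = C^2, real parts first. *)
Definition cvec (p : 'rV[R]_4) : 'rV[C]_2 :=
  \row_j (p 0 (@lshift 2 2 j) +i* p 0 (@rshift 2 2 j)).

Definition rvec (w : 'rV[C]_2) : 'rV[R]_4 :=
  row_mx (map_mx (@complex.Re R) w) (map_mx (@complex.Im R) w).

(* The affine charts [z] |-> (z_j / z_k)_{j <> k}. *)
Definition in_chart (k : 'I_3) (p : CP2) : bool := rep p 0 k != 0.

Definition chart (k : 'I_3) (p : CP2) : 'rV[R]_4 :=
  rvec (\row_i (rep p 0 (lift k i) / rep p 0 k)).

Lemma in_chart_hopf k z : in_chart k (hopf z) = (val z 0 k != 0).
Proof.
rewrite /in_chart; have [c c0 ->] := rep_hopf z.
by rewrite mxE mulf_eq0 negb_or c0.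
Qed.

Lemma chart_hopf k z :
  chart k (hopf z) = rvec (\row_i (val z 0 (lift k i) / val z 0 k)).
Proof.
rewrite /chart; have [c c0 ->] := rep_hopf z.
by congr rvec; apply/rowP => i; rewrite !mxE -mulf_div divff ?mul1r.
Qed.

(* A chart around p, the first one in index order; all the notions below     *)
(* that are computed in it are invariant under change of chart.              *)
Definition chart_at (p : CP2) : 'I_3 := odflt ord0 [pick k | in_chart k p].

Lemma chart_atP p : in_chart (chart_at p) p.
Proof.
rewrite /chart_at; case: pickP => //= no.
have /eqP : in_S5 (rep p) by exact: valP.
rewrite /herm big1 => [/eqP|j _]; first by rewrite eq_sym oner_eq0.
by have /negbFE/eqP -> := no j; rewrite mul0r.
Qed.

(* w with the entry c inserted at position k. *)
Definition insert_entry (k : 'I_3) (c : C) (w : 'rV[C]_2) : 'rV[C]_3 :=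
  \row_j (if unlift k j is Some i then w 0 i else c).

Definition cnorm (n : nat) (z : 'rV[C]_n) : R :=
  Num.sqrt (complex.Re (herm z z)).

(* The point of S^5 over the point of CP^2 with coordinates p in chart k. *)
Definition sphere_lift (k : 'I_3) (p : 'rV[R]_4) : 'rV[C]_3 :=
  let Z := insert_entry k 1 (cvec p) in (cnorm Z)^-1%:C *: Z.

Lemma herm_cnorm n (z : 'rV[C]_n) : herm z z = (cnorm z ^+ 2)%:C.
Proof.
have e : herm z z =
    (\sum_j (complex.Re (z 0 j) ^+ 2 + complex.Im (z 0 j) ^+ 2))%:C.
  rewrite /herm rmorph_sum /=; apply: eq_bigr => j _.
  by rewrite -normCK normc_def -rmorphXn /= sqr_sqrtr // addr_ge0 ?sqr_ge0.
rewrite /cnorm e /= sqr_sqrtr //.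
by apply: sumr_ge0 => j _; rewrite addr_ge0 ?sqr_ge0.
Qed.

Lemma cnorm_insert_neq0 k w : cnorm (insert_entry k 1 w) != 0.
Proof.
have := herm_cnorm (insert_entry k 1 w).
rewrite /herm (bigD1 k) //= mxE unlift_none rmorph1 mulr1 => e.
apply/eqP => n0; move: e; rewrite n0 expr0n /= => /eqP.
rewrite gt_eqF // ltr_pwDl ?ltr01 // sumr_ge0 // => j _.
by rewrite -normCK exprn_ge0.
Qed.

Lemma sphere_lift_S5 k p : in_S5 (sphere_lift k p).
Proof.
have n0 := cnorm_insert_neq0 k (cvec p).
rewrite /in_S5 /sphere_lift; set Z := insert_entry _ _ _ in n0 *.
have -> : herm ((cnorm Z)^-1%:C *: Z) ((cnorm Z)^-1%:C *: Z) =
    `|(cnorm Z)^-1%:C| ^+ 2 * herm Z Z.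
  rewrite /herm mulr_sumr normCK; apply: eq_bigr => j _.
  by rewrite !mxE rmorphM /= mulrACA.
rewrite normc_def /= expr0n addr0 sqrtr_sqr herm_cnorm -!rmorphXn -rmorphM /=.
by rewrite real_normK ?num_real // -exprMn mulVf // expr1n.
Qed.

Lemma chart_sphere_lift k p :
  chart k (hopf (exist _ (sphere_lift k p) (sphere_lift_S5 k p))) = p.
Proof.
have n0 := cnorm_insert_neq0 k (cvec p).
rewrite chart_hopf /= -[RHS](@hsubmxK _ 1 2 2 p).
rewrite (_ : \row_i _ = cvec p); last first.
  apply/rowP => i; rewrite /sphere_lift !mxE liftK unlift_none mulr1 !mxE.
  by rewrite mulrAC divff ?mul1r // -[0]/(0%:C) (inj_eq (@complexI _)) invr_eq0.
by apply: (congr2 (@row_mx R 1 2 2)); apply/rowP => i; rewrite !mxE.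
Qed.

(* The horizontal lift, at z = sphere_lift k p, of the tangent vector v of   *)
(* CP^2 at p: the part orthogonal to C z of the velocity at s = 0 of         *)
(* sphere_lift k (p + s v), the radial part of which does not matter.        *)
(* Lemmas hlift_horizontal and hlift_projects characterize it.               *)
Definition hlift (k : 'I_3) (p v : 'rV[R]_4) : 'rV[C]_3 :=
  let z := sphere_lift k p in
  let w := (cnorm (insert_entry k 1 (cvec p)))^-1%:C
             *: insert_entry k 0 (cvec v) in
  w - herm w z *: z.

Lemma hlift_horizontal k p v : herm (hlift k p v) (sphere_lift k p) = 0.
Proof.
have /eqP z1 := sphere_lift_S5 k p.
rewrite /hlift; move: (sphere_lift k p) z1 (_ *: _) => z z1 w.
have E c : herm (w - c *: z) z = herm w z - c * herm z z.
  rewrite /herm mulr_sumr -sumrB; apply: eq_bigr => j _.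
  by rewrite !mxE mulrBl mulrA.
by rewrite E z1 mulr1 subrr.
Qed.

(* The left-hand side is the differential of z |-> z_j / z_k at z along h. *)
Lemma hlift_projects k p v (i : 'I_2) :
  let z := sphere_lift k p in let h := hlift k p v in
  (h 0 (lift k i) * z 0 k - z 0 (lift k i) * h 0 k) / z 0 k ^+ 2
    = cvec v 0 i.
Proof.
have n0 := cnorm_insert_neq0 k (cvec p).
rewrite /= /hlift /=; set Z := insert_entry k 1 _ in n0 *.
set s := herm _ _; rewrite !mxE !liftK !unlift_none !mxE.
have c0 : (cnorm Z)^-1%:C != 0 :> C.
  by rewrite -[0]/(0%:C) (inj_eq (@complexI _)) invr_eq0.
move: (_%:C) c0 s => c c0 s.
by field.
Qed.

(* The metric making the Hopf projection a Riemannian submersion: the inner  *)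
(* product of tangent vectors is that of their horizontal lifts.             *)
Definition fubini_study (k : 'I_3) (p : 'rV[R]_4) : 'M[R]_4 :=
  \matrix_(a, b) complex.Re (herm (hlift k p (delta_mx 0 a))
                                  (hlift k p (delta_mx 0 b))).

(* omega(X, Y) = g(iX, Y). *)
Definition kaehler_form (k : 'I_3) (p : 'rV[R]_4) : 'M[R]_4 :=
  \matrix_(a, b) complex.Re (herm ('i *: hlift k p (delta_mx 0 a))
                                  (hlift k p (delta_mx 0 b))).

(* A may be any subset of V: smoothness at a point of A means agreeing near  *)
(* it, on A and in some chart, with a map that is smooth on an open set.     *)
Definition smooth_map (V : normedModType R) (A : set V) (f : V -> CP2) : Prop :=
  forall x, A x -> exists k (U : set V) (g : V -> 'rV[R]_4),
    [/\ U x, smooth U g &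
        forall y, A y -> U y -> in_chart k (f y) /\ chart k (f y) = g y].

End ProjectivePlane.
Arguments CP2 : clear implicits.

Section Tori.
Context {R : realType}.
Local Notation R2 := ('rV[R]_2).

(* The torus is R^2 / Z^2; maps and tensors on it are Z^2-periodic ones on   *)
(* R^2.                                                                      *)
Definition torus_eq (x y : R2) : Prop :=
  exists n : 'rV[int]_2, y = x + map_mx intr n.

(* f near x, read in a chart around f x. *)
Definition local_rep (f : R2 -> CP2 R) (x : R2) : R2 -> 'rV[R]_4 :=
  fun y => chart (chart_at (f x)) (f y).

Definition immersed_torus (f : R2 -> CP2 R) : Prop :=
  [/\ forall x y, torus_eq x y -> f x = f y,
      smooth_map setT f &
      forall x, row_free (jac (local_rep f x) x)].

Definition induced_metric (f : R2 -> CP2 R) (x : R2) : 'M[R]_2 :=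
  pullback (fubini_study (chart_at (f x))) (local_rep f x) x.

Definition lagrangian (f : R2 -> CP2 R) : Prop :=
  forall x, pullback (kaehler_form (chart_at (f x))) (local_rep f x) x = 0.

Definition minimal (f : R2 -> CP2 R) : Prop :=
  forall x,
    mean_curvature (fubini_study (chart_at (f x))) (local_rep f x) x = 0.

Definition minimal_lagrangian_torus (f : R2 -> CP2 R) : Prop :=
  [/\ immersed_torus f, lagrangian f & minimal f].

Definition point2 (p : R * R) : R2 := \row_i (if i == 0 then p.1 else p.2).

Definition area (f : R2 -> CP2 R) : \bar R :=
  (\int[(@lebesgue_measure R) \x (@lebesgue_measure R)]_(
      p in `[0%R, 1%R] `*` `[0%R, 1%R])
    (Num.sqrt (\det (induced_metric f (point2 p))))%:E)%E.

(* phi is a lift to R^2 of a diffeomorphism of the torus. *)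
Definition torus_diffeo (phi : R2 -> R2) : Prop :=
  smooth setT phi /\
  (exists psi, [/\ smooth setT psi, cancel phi psi & cancel psi phi]) /\
  (forall x y, torus_eq x y <-> torus_eq (phi x) (phi y)).

Definition conformally_equivalent (g h : R2 -> 'M[R]_2) : Prop :=
  exists (phi : R2 -> R2) (lambda : R2 -> R),
    [/\ torus_diffeo phi, smooth setT lambda, forall x, 0 < lambda x &
        forall x, pullback h phi x = lambda x *: g x].

(* Joint smoothness in (t, x) is required on I x R^2 only. *)
Definition smooth_deformation (I : interval R) (f0 : R2 -> CP2 R)
    (f : R -> R2 -> CP2 R) : Prop :=
  [/\ 0 \in I, f 0 = f0,
      forall t, t \in I -> immersed_torus (f t) &
      smooth_map [set tx : R * R2 | tx.1 \in I] (fun tx => f tx.1 tx.2)].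

Definition preserves_conformal_type (I : interval R) (f0 : R2 -> CP2 R)
    (f : R -> R2 -> CP2 R) : Prop :=
  forall t, t \in I ->
    conformally_equivalent (induced_metric (f t)) (induced_metric f0).

End Tori.

(* Main.v *)
Require Import Defs.
From mathcomp Require Import all_boot all_order all_algebra generic_quotient.
From mathcomp Require Import complex ring lra.
From mathcomp Require Import all_classical all_reals all_analysis.

(* First variation of area. Write g for the induced metric of Sigma_t,        *)
(* a = sqrt (det g) for the area density and W^i = a g^{ij} <d_t S, d_j S>.   *)
(* For the Levi-Civita connection (metric and torsion free),                  *)
(* d_t a = d_i W^i - a <H, d_t S>, so that d_t a = d_i W^i when the mean      *)
(* curvature H vanishes. The field W does not depend on charts and is         *)
(* Z^2-periodic, so d_t a has integral 0 over the unit square and the area,   *)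
(* continuous on the interval of deformation, has derivative 0 inside it.     *)
(* Chart independence of the inner products <d_v S, d_w S> comes from         *)
(* 1 - |<z, w>|^2, which is a function of the points [z], [w] of CP^2 and     *)
(* whose leading term as [w] tends to [z] is the Fubini-Study metric.         *)

Set Implicit Arguments.
Unset Strict Implicit.
Unset Printing Implicit Defensive.

Import Order.TTheory GRing.Theory Num.Theory.
Import numFieldNormedType.Exports.

Local Open Scope classical_set_scope.
Local Open Scope complex_scope.
Local Open Scope ring_scope.

(** * Functions of class C^k *)

(** A minimal surface is a critical point of area. In a family whose members are all minimal, the
    area therefore has derivative 0 at every interior time; since it is also continuous up to the
    ends of each compact time interval, it is constant.

    The pointwise identity is [first_variation], proved in one chart for a map of space-time (t, x).
    [metric_compatible] and [connection_torsion_free] trade each derivative of the Gram matrix for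
    inner products with second covariant derivatives, and what remains is algebra. Minimality enters
    through [mean_curvature_eq0], with denominators cleared, and [minimal_slice] carries it from the
    slices x |-> Sigma_t(x) to space-time.

    Two facts make the identity global. By [fs_chart_independent], the inner products [gram] do not
    depend on the chart, so [density] and [torus_flux] are locally C^1, periodic, and satisfy
    [density_divergence] at all interior times. By [square_integral_dx] and [square_integral_dy],
    the divergence of a periodic field has integral 0 over the unit square. Compactness of the
    square ([tube]) justifies differentiation under the integral sign, and [constant_integral]
    concludes with the mean value theorem. *)

Section DifferentiableTimes.
Context {R : realType} {V : normedModType R}.
Implicit Types (U : set V).

Section General.
Context {W : normedModType R}.
Implicit Types (f g : V -> W).

(** The first-order expansion of [f] at [x] is also one of [g], and such an expansion determines the
    differential. *)
Lemma near_eq_differentiable f g x :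
  {near x, f =1 g} -> differentiable f x -> differentiable g x.
Proof.
move=> fg /diff_locallyP[df /eqaddoP fE].
have gE : g \o shift x = cst (g x) + 'd f x +o_ 0 id.
  apply/eqaddoP => e e0; have h := fE _ e0.
  have fg0 : \forall y \near (0 : V), f (y + x) = g (y + x).
    have /nbhs0P := fg; apply: filterS => y; by rewrite addrC.
  apply: filterS2 fg0 h => y fgy.
  by rewrite /= !fctE /= -(nbhs_singleton fg) -fgy.
by apply/diff_locallyP; rewrite (diff_unique df gE).
Qed.

(** Agreement on an open set passes to directional derivatives. This lets the inductions below
    replace a derivative by the formula that computes it on [U]. *)
Lemma differentiable_times_eq k U f g : open U -> {in U, f =1 g} ->
  differentiable_times k U f -> differentiable_times k U g.
Proof.
move=> oU; elim: k f g => [|k IH] f g fg /=.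
  move=> cf x Ux; have fgx : {near x, f =1 g}.
    by apply: filterS (open_nbhs_nbhs (conj oU Ux)) => y Uy; apply: fg; rewrite inE.
  rewrite /prop_for /continuous_at -(nbhs_singleton fgx).
  by apply: cvg_trans (cf x Ux); apply: near_eq_cvg.
move=> [df ck]; have fgx x : U x -> {near x, f =1 g}.
  by move=> Ux; apply: filterS (open_nbhs_nbhs (conj oU Ux)) => y Uy; apply: fg; rewrite inE.
split=> [x Ux|v]; first exact: near_eq_differentiable (fgx x Ux) (df x Ux).
apply: IH (ck v) => x; rewrite inE => Ux; apply: near_eq_derive; exact: fgx.
Qed.

Lemma differentiable_times_sub k U U' f : U' `<=` U ->
  differentiable_times k U f -> differentiable_times k U' f.
Proof.
move=> sU; elim: k f => [|k IH] f /=; first by move=> cf x /sU /cf.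
by move=> [df ck]; split=> [x /sU /df//|v]; exact: IH.
Qed.

Lemma differentiable_timesW k U f :
  differentiable_times k.+1 U f -> differentiable_times k U f.
Proof.
elim: k f => [|k IH] f [df ck].
  by move=> x Ux; apply/differentiable_continuous/df.
by split=> // v; apply: IH.
Qed.

Lemma differentiable_times_cst k U (c : W) : differentiable_times k U (cst c).
Proof.
elim: k c => [|k IH] c; first by move=> x _; exact: cst_continuous.
split=> [x _|v]; first exact: differentiable_cst.
have -> : 'D_v (cst c : V -> W) = cst 0 by apply/funext => x; exact: derive_cst.
exact: IH.
Qed.

Lemma differentiable_timesD k U f g : open U ->
  differentiable_times k U f -> differentiable_times k U g ->
  differentiable_times k U (fun x => f x + g x).
Proof.
move=> oU; elim: k f g => [|k IH] f g /=.
  by move=> cf cg x Ux; apply: continuousD; [exact: cf|exact: cg].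
move=> [df cf] [dg cg]; split=> [x Ux|v].
  by apply: differentiableD; [exact: df|exact: dg].
apply: differentiable_times_eq (IH _ _ (cf v) (cg v)) => // x; rewrite inE => Ux.
by rewrite -deriveD//; apply/diff_derivable; [exact: df|exact: dg].
Qed.

End General.

Implicit Types f g : V -> R.

Lemma differentiable_timesM k U f g : open U ->
  differentiable_times k U f -> differentiable_times k U g ->
  differentiable_times k U (fun x => f x * g x).
Proof.
move=> oU; elim: k f g => [|k IH] f g.
  by move=> cf cg x Ux; apply: continuousM; [exact: cf|exact: cg].
move=> Df Dg; have [[df cf] [dg cg]] := (Df, Dg); split=> [x Ux|v].
  by apply: differentiableM; [exact: df|exact: dg].
have := differentiable_timesD oU (IH _ _ (differentiable_timesW Df) (cg v))
  (IH _ _ (differentiable_timesW Dg) (cf v)).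
apply: differentiable_times_eq => // x; rewrite inE => Ux.
by rewrite (deriveM (diff_derivable (df _ Ux)) (diff_derivable (dg _ Ux))).
Qed.

Lemma differentiable_timesN k U f : open U ->
  differentiable_times k U f -> differentiable_times k U (fun x => - f x).
Proof.
move=> oU Df; have := differentiable_timesM oU (differentiable_times_cst k U (-1 : R)) Df.
by apply: differentiable_times_eq => // x _ /=; rewrite mulN1r.
Qed.

Lemma differentiable_timesB k U f g : open U ->
  differentiable_times k U f -> differentiable_times k U g ->
  differentiable_times k U (fun x => f x - g x).
Proof.
by move=> oU Df Dg; apply: differentiable_timesD => //; exact: differentiable_timesN.
Qed.

(** The derivative of 1/f is - (1/f) (1/f) f', in which 1/f has one order of regularity less and is
    covered by induction. The square root below is treated in the same way. *)
Lemma differentiable_timesV k U f : open U -> (forall x, U x -> f x != 0) ->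
  differentiable_times k U f -> differentiable_times k U (fun x => (f x)^-1).
Proof.
move=> oU f0; elim: k => [|k IH].
  by move=> cf x Ux; apply: continuousV; [exact: f0|exact: cf].
move=> Df; have [df cf] := Df; split=> [x Ux|v].
  by apply: differentiableV; [exact: df|exact: f0].
have IH' := IH (differentiable_timesW Df).
have := differentiable_timesN oU
  (differentiable_timesM oU (differentiable_timesM oU IH' IH') (cf v)).
apply: differentiable_times_eq => // x; rewrite inE => Ux.
rewrite (deriveV (f0 _ Ux) (diff_derivable (df _ Ux))).
by rewrite -expr2 exprVn scaleNr.
Qed.

Lemma differentiable_sqrt f x : 0 < f x -> differentiable f x ->
  differentiable (fun y => Num.sqrt (f y)) x.
Proof.
move=> f0 df; apply: (@differentiable_comp _ _ _ _ f Num.sqrt) => //.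
by apply/derivable1_diffP; have [] := is_derive1_sqrt f0.
Qed.

Lemma derive_sqrt_comp f x v : 0 < f x -> differentiable f x ->
  'D_v (fun y => Num.sqrt (f y)) x = 'D_v f x / (2 * Num.sqrt (f x)).
Proof.
move=> f0 df; rewrite deriveE; last exact: differentiable_sqrt.
have ds : differentiable (@Num.sqrt R) (f x).
  by apply/derivable1_diffP; have [] := is_derive1_sqrt f0.
by rewrite (diff_comp df ds) /= deriv1E ?derive1E ?derive_sqrt ?deriveE//;
  apply/derivable1_diffP.
Qed.

Lemma differentiable_times_sqrt k U f : open U -> (forall x, U x -> 0 < f x) ->
  differentiable_times k U f -> differentiable_times k U (fun x => Num.sqrt (f x)).
Proof.
move=> oU f0; elim: k => [|k IH].
  move=> cf x Ux; apply: (continuous_comp (cf x Ux)); exact: sqrt_continuous.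
move=> Df; have [df cf] := Df; split=> [x Ux|v].
  by apply: differentiable_sqrt; [exact: f0|exact: df].
have IH' := IH (differentiable_timesW Df).
have s0 x : U x -> 2 * Num.sqrt (f x) != 0.
  by move=> Ux; rewrite mulf_neq0 ?pnatr_eq0// gt_eqF// sqrtr_gt0 f0.
have := differentiable_timesM oU (cf v) (differentiable_timesV oU s0
  (differentiable_timesM oU (differentiable_times_cst k U (2 : R)) IH')).
apply: differentiable_times_eq => // x; rewrite inE => Ux.
by rewrite derive_sqrt_comp; [|exact: f0|exact: df].
Qed.

Lemma differentiable_times_sum k U n (f : 'I_n -> V -> R) : open U ->
  (forall i, differentiable_times k U (f i)) ->
  differentiable_times k U (fun x => \sum_i f i x).
Proof.
move=> oU; elim: n f => [|n IH] f Df.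
  have := differentiable_times_cst k U (0:R).
  by apply: differentiable_times_eq => // x _; rewrite big_ord0.
have := differentiable_timesD oU (IH _ (fun i => Df (lift ord_max i)))  (Df ord_max).
apply: differentiable_times_eq => // x _; rewrite big_ord_recr /=; congr (_ + _).
by apply: eq_bigr => i _; congr (f _ x); apply/val_inj; rewrite /= /bump leqNgt ltn_ord.
Qed.

Lemma differentiable_times_coord k U m n (f : V -> 'M[R]_(m, n)) i j : open U ->
  differentiable_times k U f -> differentiable_times k U (fun x => f x i j).
Proof.
move=> oU; elim: k f => [|k IH] f.
  move=> cf x Ux; exact: (continuous_comp (cf x Ux) (@coord_continuous _ _ _ i j _)).
move=> [df cf]; split=> [x Ux|v].
  exact: (differentiable_comp (df x Ux) (@differentiable_coord _ _ _ _ i j)).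
apply: differentiable_times_eq (IH _ (cf v)) => // x; rewrite inE => Ux.
by rewrite derive_mx ?mxE//; exact/diff_derivable/df.
Qed.

End DifferentiableTimes.

(** * Symmetry of second derivatives and the chain rule *)

Section Schwarz.
Context {R : realType} {V : normedModType R}.
Implicit Types (U : set V) (f : V -> R) (v w x y : V).

Lemma is_derive_line f y v (s : R) : derivable f (s *: v + y) v ->
  is_derive s 1 (fun s => f (s *: v + y)) ('D_v f (s *: v + y)).
Proof.
move=> df.
have E : (fun h : R => h^-1 *: (((fun s => f (s *: v + y)) \o shift s) (h *: (1 : R)) - f (s *: v + y)))
    = (fun h : R => h^-1 *: ((f \o shift (s *: v + y)) (h *: v) - f (s *: v + y))).
  by apply/funext => h /=; rewrite scalerDl -addrA (_ : h *: (1 : R) = h) // /GRing.scale /= mulr1.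
split; first by rewrite /derivable E.
by rewrite /derive E.
Qed.

Lemma MVT_line f y v (h : R) : 0 <= h ->
  (forall s, s \in `[0, h] -> differentiable f (s *: v + y)) ->
  exists2 s, s \in `[0, h] & f (h *: v + y) - f y = h * 'D_v f (s *: v + y).
Proof.
move=> h0 df.
have dl s : s \in `[0, h] ->
    is_derive s 1 (fun s => f (s *: v + y)) ('D_v f (s *: v + y)).
  by move=> /df /diff_derivable ?; exact: is_derive_line.
have dl' s : s \in `]0, h[ ->
    is_derive s 1 (fun s => f (s *: v + y)) ('D_v f (s *: v + y)).
  by move=> sh; apply: dl; apply: subset_itv_oo_cc sh.
have cl : {within `[0, h], continuous (fun s => f (s *: v + y))}.
  by apply: derivable_within_continuous => s /dl [].
have [s sh E] := MVT_segment h0 dl' cl.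
by exists s => //; rewrite -(subr0 h) [RHS]mulrC -E subr0 scale0r add0r.
Qed.

Lemma differentiable_translate f a y :
  differentiable f (a + y) -> differentiable (fun y => f (a + y)) y.
Proof.
move=> df; have da : differentiable (fun y : V => a + y) y.
  by apply: differentiableD.
exact: (differentiable_comp da df).
Qed.

Lemma derive_translate (W : normedModType R) (f : V -> W) a y v :
  'D_v (fun y => f (a + y)) y = 'D_v f (a + y).
Proof.
rewrite /derive (_ : (fun h : R => _) =
  (fun h => h^-1 *: ((f \o shift (a + y)) (h *: v) - f (a + y)))) //.
by apply/funext => h /=; rewrite addrCA.
Qed.

(** The mean value theorem is applied twice: along [v] to the increment of [f] by [h *: w], then
    along [w] to ['D_v f]. The left-hand side is symmetric in [v] and [w]. *)
Lemma second_difference U f x v w (h : R) : 0 <= h ->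
  differentiable_times 2 U f ->
  (forall s t, s \in `[0, h] -> t \in `[0, h] -> U (s *: v + (t *: w + x))) ->
  exists s t, [/\ s \in `[0, h], t \in `[0, h] &
    f (h *: v + (h *: w + x)) - f (h *: v + x) - f (h *: w + x) + f x =
    h * (h * 'D_w ('D_v f) (s *: v + (t *: w + x)))].
Proof.
move=> h0 [df ddf] Uh.
have m0 : 0 \in `[0, h] by rewrite in_itv /= lexx.
have mh : h \in `[0, h] by rewrite in_itv /= lexx h0.
have dfs s : s \in `[0, h] -> differentiable f (s *: v + x).
  by move=> sh; have := df _ (Uh s 0 sh m0); rewrite scale0r add0r.
have dfhs s : s \in `[0, h] ->
    differentiable (fun y => f (h *: w + y)) (s *: v + x).
  move=> sh; apply: differentiable_translate; rewrite addrCA; exact/df/Uh.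
have dg s : s \in `[0, h] ->
    differentiable ((fun y => f (h *: w + y)) - f) (s *: v + x).
  by move=> sh; apply: differentiableB; [exact: dfhs | exact: dfs].
have [s sh gE] := MVT_line h0 dg.
have Dg : 'D_v ((fun y => f (h *: w + y)) - f) (s *: v + x) =
    'D_v f (h *: w + (s *: v + x)) - 'D_v f (s *: v + x).
  rewrite deriveB; first by rewrite derive_translate.
    exact/diff_derivable/dfhs.
  exact/diff_derivable/dfs.
have ddfw t : t \in `[0, h] -> differentiable ('D_v f) (t *: w + (s *: v + x)).
  by move=> th; apply: (ddf v).1; rewrite addrCA; exact: Uh.
have [t th fE] := MVT_line h0 ddfw.
exists s, t; split => //; rewrite [s *: v + _]addrCA -fE -Dg -gE.
rewrite -![(_ - _ : _ -> _) _]/(_ - _) (addrCA (h *: w)).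
by move: (f _) (f _) (f _) (f _) => a b c d; ring.
Qed.

Lemma continuous2_ball U (A B : V -> R) x (e : R) : open U -> U x -> 0 < e ->
  {for x, continuous A} -> {for x, continuous B} ->
  exists2 r : R, 0 < r & forall y, `|y - x| < r ->
    [/\ U y, `|A x - A y| < e & `|B x - B y| < e].
Proof.
move=> oU Ux e0 cA cB.
have h1 := open_nbhs_nbhs (conj oU Ux).
have /cvgrPdist_lt/(_ _ e0) h2 := cA.
have /cvgrPdist_lt/(_ _ e0) h3 := cB.
have [r r0 rP] := (nbhs_ballP x _).1 (filterI h1 (filterI h2 h3)).
exists r => // y yx.
have [] : (U `&` ([set t | `|A x - A t| < e] `&` [set t | `|B x - B t| < e])) y.
  by apply: rP; rewrite -ball_normE /= distrC.
by move=> ? [? ?]; split.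
Qed.

(** The second difference equals h^2 times either mixed derivative, each taken at some point near
    [x]. Continuity of both at [x] leaves a gap of at most [e] between their values there, for every
    positive [e]. *)
Lemma Schwarz U f x v w : open U -> U x -> differentiable_times 2 U f ->
  'D_v ('D_w f) x = 'D_w ('D_v f) x.
Proof.
move=> oU Ux Df; have [_ ddf] := Df.
pose sd v w (B : V -> R) := forall h, 0 <= h ->
  (forall s t, s \in `[0, h] -> t \in `[0, h] -> U (s *: v + (t *: w + x))) ->
  exists s t, [/\ s \in `[0, h], t \in `[0, h] &
    f (h *: v + (h *: w + x)) - f (h *: v + x) - f (h *: w + x) + f x =
    h * (h * B (s *: v + (t *: w + x)))].
suff H (A B : V -> R) : sd w v A -> sd v w B ->
    {for x, continuous A} -> {for x, continuous B} -> A x = B x.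
  apply: (H ('D_v ('D_w f)) ('D_w ('D_v f))).
  - by move=> h h0; exact: second_difference.
  - by move=> h h0; exact: second_difference.
  - exact: (ddf w).2.
  - exact: (ddf v).2.
move=> dA dB cA cB.
apply/eqP; rewrite -subr_eq0 -normr_le0; apply/ler_addgt0Pl => e e0; rewrite addr0.
have e2 : 0 < e / 2 by rewrite divr_gt0.
have [r r0 rP] := continuous2_ball oU Ux e2 cA cB.
(* The parallelogram spanned by [h *: v] and [h *: w] at [x] has to lie in the ball of radius [r];
   the summand 1 keeps [n] positive when both vectors vanish. *)
pose n := `|v| + `|w| + 1.
have n0 : 0 < n by rewrite ltr_wpDl// addr_ge0.
pose h := r / n / 2.
have h0 : 0 < h by rewrite !divr_gt0.
have inball s t : s \in `[0, h] -> t \in `[0, h] ->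
    `|(s *: v + (t *: w + x)) - x| < r.
  rewrite !in_itv /= => /andP[s0 sh] /andP[t0 th].
  rewrite addrA addrK (le_lt_trans (ler_normD _ _))// !normrZ !ger0_norm//.
  apply: (@le_lt_trans _ _ (h * n)).
    rewrite /n !mulrDr -[leLHS]addr0; apply: lerD; last by rewrite mulr1 ltW.
    by rewrite lerD// ler_wpM2r.
  rewrite /h mulrAC divfK ?gt_eqF// ltr_pdivrMr// ltr_pMr// ltr1n//.
have [s [t [sh th E1]]] := dB h (ltW h0)
  (fun s t sh th => let: And3 H _ _ := rP _ (inball s t sh th) in H).
have [s' [t' [sh' th' E2]]] := dA h (ltW h0)
  (fun s t sh th => let: And3 H _ _ := rP _ (let E := inball t s th sh in
     eq_rect _ (fun z => `|z - x| < r) E _ (addrCA _ _ _)) in H).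
have E : B (s *: v + (t *: w + x)) = A (s' *: w + (t' *: v + x)).
  apply: (@mulfI _ h); first by rewrite gt_eqF.
  apply: (@mulfI _ h); first by rewrite gt_eqF.
  by rewrite -E1 -E2 (addrCA (h *: w)); ring.
have [_ _ b1] := rP _ (inball s t sh th).
have [_ b2 _] := rP _ (inball t' s' th' sh').
rewrite addrCA -E in b2.
rewrite -(subrKA (B (s *: v + (t *: w + x)))).
rewrite (le_trans (ler_normD _ _))// (splitr e) lerD// ltW//.
by rewrite distrC.
Qed.

Lemma derive_chain (W : normedModType R) n (G : 'rV[R]_n -> W) (u : V -> 'rV[R]_n)
    y v :
  differentiable u y -> differentiable G (u y) ->
  'D_v (G \o u) y = \sum_c ('D_v u y) 0 c *: 'D_(delta_mx 0 c) G (u y).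
Proof.
move=> du dG; rewrite deriveE; last exact: differentiable_comp.
rewrite diff_comp //= -(deriveE _ du); move: ('D_v u y) => w.
rewrite [X in 'd G _ X]row_sum_delta linear_sum /=.
by apply: eq_bigr => c _; rewrite linearZ /= deriveE.
Qed.

End Schwarz.

(** * The Levi-Civita connection and the first variation of area *)

Section PointwiseDerivatives.
Context {R : realType} {V : normedModType R}.
Implicit Types (f g : V -> R) (x v : V).

Lemma derive_subE f g x v : differentiable f x -> differentiable g x ->
  'D_v (fun y => f y - g y) x = 'D_v f x - 'D_v g x.
Proof. by move=> df dg; rewrite -deriveB//; exact: diff_derivable. Qed.

Lemma derive_mulE f g x v : differentiable f x -> differentiable g x ->
  'D_v (fun y => f y * g y) x = 'D_v f x * g x + f x * 'D_v g x.
Proof.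
move=> df dg; rewrite (deriveM (diff_derivable df) (diff_derivable dg)).
by rewrite addrC [_ *: _]mulrC.
Qed.

Lemma derive_divE f g x v : differentiable f x -> differentiable g x ->
  g x != 0 ->
  'D_v (fun y => f y / g y) x = ('D_v f x * g x - f x * 'D_v g x) / g x ^+ 2.
Proof.
move=> df dg g0; rewrite derive_mulE //; last exact: differentiableV.
rewrite (deriveV g0 (diff_derivable dg)) scaleNr [_ *: _]mulrC; by field.
Qed.

Lemma differentiable_sumE n (F : 'I_n -> V -> R) x :
  (forall i, differentiable (F i) x) -> differentiable (fun y => \sum_i F i y) x.
Proof.
move=> dF; have -> : (fun y => \sum_i F i y) = \sum_i F i.
  by apply/funext => y; rewrite fct_sumE.
exact: differentiable_sum.
Qed.

Lemma derive_sumE n (F : 'I_n -> V -> R) x v :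
  (forall i, differentiable (F i) x) ->
  'D_v (fun y => \sum_i F i y) x = \sum_i 'D_v (F i) x.
Proof.
move=> dF; rewrite -derive_sum; last by move=> i; exact/diff_derivable.
by congr (derive _ x v); apply/funext => y; rewrite fct_sumE.
Qed.

Lemma differentiable_entry m n (X : V -> 'M[R]_(m, n)) i j x :
  differentiable X x -> differentiable (fun y => X y i j) x.
Proof.
by move=> dX; exact: (differentiable_comp dX (@differentiable_coord _ _ _ _ i j)).
Qed.

Lemma derive_entry m n (X : V -> 'M[R]_(m, n)) i j x v :
  differentiable X x -> 'D_v (fun y => X y i j) x = ('D_v X x) i j.
Proof. by move=> dX; rewrite derive_mx ?mxE//; exact: diff_derivable. Qed.

End PointwiseDerivatives.

(** The shape of the first variation formula once all derivatives are expanded: [a] is the area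
    density, [p], [q1], [q2] are derivatives of its square, and [m1 / a], [m2 / a] are the flux
    components, [n1], [n2] being the derivatives of their numerators. The hypothesis is the
    conclusion multiplied by 2 a^3. *)
Lemma quotient_derivatives (F : numFieldType) (a p n1 n2 m1 m2 q1 q2 : F) :
  a != 0 -> a ^+ 2 * p = 2 * a ^+ 2 * (n1 + n2) - m1 * q1 - m2 * q2 ->
  p / (2 * a) = (n1 * a - m1 * (q1 / (2 * a))) / a ^+ 2 +
                (n2 * a - m2 * (q2 / (2 * a))) / a ^+ 2.
Proof.
move=> a0 E; have -> : p = (a ^+ 2 * p) / a ^+ 2 by field.
by rewrite E; field.
Qed.

Section LeviCivita.
Context {R : realType} {n : nat} (G : 'rV[R]_n -> 'M[R]_n).
Hypothesis Gsym : forall p a b, G p a b = G p b a.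
Hypothesis Gunit : forall p, G p \in unitmx.
Hypothesis Gdiff : forall p a b, differentiable (fun q => G q a b) p.
Implicit Types (p T X Y dX : 'rV[R]_n).

Definition inner p X Y : R := \sum_a \sum_b X 0 a * Y 0 b * G p a b.

(** The covariant derivative at [p] of a vector field along a map: [T] is the velocity of the map,
    [X] the value of the field, [dX] its coordinatewise derivative. *)
Definition connection p T X dX : 'rV[R]_n :=
  \row_c (dX 0 c + \sum_a \sum_b christoffel G p c a b * T 0 a * X 0 b).

Lemma innerE p X Y : inner p X Y = (X *m G p *m Y^T) 0 0.
Proof.
rewrite /inner mxE exchange_big /=; apply: eq_bigr => b _.
by rewrite !mxE mulr_suml; apply: eq_bigr => a _; rewrite mulrAC.
Qed.

Lemma inner_sym p X Y : inner p X Y = inner p Y X.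
Proof.
rewrite /inner exchange_big; apply: eq_bigr => b _; apply: eq_bigr => a _.
by rewrite Gsym (mulrC (X 0 _)).
Qed.

Let Gfun_sym a b : (fun q => G q a b) = (fun q => G q b a).
Proof. by apply/funext => q; exact: Gsym. Qed.

Lemma christoffel_sym p c a b : christoffel G p c a b = christoffel G p c b a.
Proof.
rewrite /christoffel; congr (_ * _); apply: eq_bigr => d _; congr (_ * _).
rewrite (Gfun_sym d b) (Gfun_sym a d) (Gfun_sym d a) (Gfun_sym b d) (Gfun_sym a b).
by rewrite (addrC (pd a _ p)).
Qed.

Lemma connection_sym p T X dX : connection p T X dX = connection p X T dX.
Proof.
apply/rowP => c; rewrite !mxE; congr (_ + _); rewrite exchange_big /=.
apply: eq_bigr => a _; apply: eq_bigr => b _.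
by rewrite christoffel_sym mulrAC.
Qed.

(** Contraction with [G] cancels the inverse matrix inside [christoffel] and leaves the Koszul
    formula. *)
Lemma christoffel_lower p a b d :
  \sum_c christoffel G p c a b * G p c d =
  2^-1 * (pd a (fun q => G q d b) p + pd b (fun q => G q a d) p
          - pd d (fun q => G q a b) p).
Proof.
have inv e : \sum_c invmx (G p) c e * G p c d = (e == d)%:R.
  have := congr1 (fun M : 'M[R]_n => M d e) (mulmxV (Gunit p)).
  rewrite !mxE eq_sym => <-; apply: eq_bigr => c _.
  by rewrite Gsym mulrC.
rewrite /christoffel; under eq_bigr do rewrite -mulrA mulr_suml.
rewrite -mulr_sumr; congr (_ * _); rewrite exchange_big /=.
rewrite (bigD1 d) //= [X in _ + X]big1 ?addr0 => [|e ed].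
  under eq_bigr do rewrite mulrAC.
  by rewrite -mulr_suml inv eqxx mul1r.
under eq_bigr do rewrite mulrAC.
by rewrite -mulr_suml inv (negPf ed) mul0r.
Qed.

Lemma inner_connection p T X dX Y :
  inner p (connection p T X dX) Y = inner p dX Y +
  \sum_a \sum_b \sum_d T 0 a * X 0 b * Y 0 d *
   (\sum_c christoffel G p c a b * G p c d).
Proof.
rewrite /inner; under eq_bigr => c _.
  under eq_bigr => d _ do rewrite mxE mulrDl mulrDl.
  rewrite big_split /=; over.
rewrite big_split /=; congr (_ + _).
under eq_bigr => c _ do under eq_bigr => d _ do
  (rewrite !mulr_suml; under eq_bigr => a _ do rewrite !mulr_suml).
rewrite exchange_big /=.
under eq_bigr => d _ do rewrite exchange_big /=.
rewrite exchange_big /=; apply: eq_bigr => a _.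
under eq_bigr => d _ do rewrite exchange_big /=.
rewrite exchange_big /=; apply: eq_bigr => b _; apply: eq_bigr => d _.
rewrite mulr_sumr; apply: eq_bigr => c _; ring.
Qed.

(** With lowered indices, the Koszul formula gives Gamma_{abd} + Gamma_{adb} = d_a G_{bd}, which is
    exactly the term that the chain rule produces from the dependence of [G] on the base point. *)
Lemma metric_compatible (V : normedModType R) (u X Y : V -> 'rV[R]_n) y v :
  differentiable u y -> differentiable X y -> differentiable Y y ->
  'D_v (fun z => inner (u z) (X z) (Y z)) y =
  inner (u y) (connection (u y) ('D_v u y) (X y) ('D_v X y)) (Y y) +
  inner (u y) (X y) (connection (u y) ('D_v u y) (Y y) ('D_v Y y)).
Proof.
move=> du dX dY.
have dXa a : differentiable (fun z => X z 0 a) y by exact: differentiable_entry.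
have dYa a : differentiable (fun z => Y z 0 a) y by exact: differentiable_entry.
have dG a b : differentiable (fun z => G (u z) a b) y.
  exact: (differentiable_comp du (Gdiff _ a b)).
rewrite [in LHS]/inner derive_sumE; last first.
  move=> a; apply: differentiable_sumE => b; do !apply: differentiableM => //.
rewrite (inner_sym _ (X y)) !inner_connection.
set p := u y; set T := 'D_v u y.
have -> : \sum_i 'D_v (fun z => \sum_b X z 0 i * Y z 0 b * G (u z) i b) y =
   inner p ('D_v X y) (Y y) + inner p (X y) ('D_v Y y) +
   \sum_a \sum_b \sum_d T 0 a * X y 0 b * Y y 0 d * pd a (fun q => G q b d) p.
  rewrite [in inner p ('D_v X y) _]/inner [in inner p (X y) _]/inner.
  rewrite -big_split /=; rewrite [X in _ = _ + X]exchange_big /=.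
  under [X in _ = _ + X]eq_bigr do rewrite exchange_big /=.
  rewrite -big_split /=; apply: eq_bigr => a _.
  rewrite derive_sumE => [|b]; last by do !apply: differentiableM => //.
  rewrite -!big_split /=; apply: eq_bigr => b _.
  rewrite derive_mulE //; last by apply: differentiableM.
  rewrite derive_mulE //.
  have -> : 'D_v (fun z => G (u z) a b) y =
      \sum_c T 0 c * pd c (fun q => G q a b) p.
    by have := derive_chain v du (Gdiff (u y) a b).
  rewrite (derive_entry _ _ _ dX) (derive_entry _ _ _ dY).
  rewrite mulr_sumr mulrDl -!addrA; congr (_ + (_ + _)).
  by apply: eq_bigr => c _; ring.
rewrite -!addrA; congr (_ + _); rewrite inner_sym addrCA; congr (_ + _).
rewrite -big_split /=; apply: eq_bigr => a _.
rewrite [X in _ = _ + X]exchange_big -big_split /=; apply: eq_bigr => b _.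
rewrite -big_split /=; apply: eq_bigr => d _; rewrite !christoffel_lower.
rewrite (Gfun_sym d b) (Gfun_sym a d) (Gfun_sym d a) (Gfun_sym a b).
move: (pd _ _ _) (pd _ _ _) (pd _ _ _) => P Q S; by field.
Qed.

Section FirstVariation.
Context {V : normedModType R} (U : set V) (u : V -> 'rV[R]_n).
Context (X : V -> V -> 'rV[R]_n) (X2 : V -> V -> V -> 'rV[R]_n).
Hypothesis oU : open U.
Hypothesis Du : differentiable_times 2 U u.
(* X and X2 name the first and second derivatives of u as opaque functions,   *)
(* which keeps unification from unfolding 'D_v u.                             *)
Hypothesis XE : forall v y, 'D_v u y = X v y.
Hypothesis X2E : forall t v y, 'D_t (X v) y = X2 t v y.

Let dX v y : U y -> differentiable (X v) y.
Proof.
move=> Uy; have := (Du.2 v).1 y Uy.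
by rewrite (_ : 'D_v u = X v) //; apply/funext => z; exact: XE.
Qed.

(** This is nabla_v (d_w u), the covariant derivative along [u]. *)
Let B v w y := connection (u y) (X v y) (X w y) (X2 v w y).
Let g v w y := inner (u y) (X v y) (X w y).

Lemma derivative_sym v w y : U y -> X2 v w y = X2 w v y.
Proof.
move=> Uy; apply/rowP => a.
rewrite -!X2E -(derive_entry _ _ _ (dX w Uy)) -(derive_entry _ _ _ (dX v Uy)).
have := Schwarz v w oU Uy (differentiable_times_coord 0 a oU Du).
have nE t : \forall z \near y, 'D_t (fun z => u z 0 a) z = X t z 0 a.
  apply: filterS (open_nbhs_nbhs (conj oU Uy)) => z Uz.
  by rewrite derive_entry ?XE //; exact: Du.1.
by rewrite (near_eq_derive v (nE w)) (near_eq_derive w (nE v)).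
Qed.

Lemma connection_torsion_free v w y : U y -> B v w y = B w v y.
Proof. by move=> Uy; rewrite /B connection_sym derivative_sym. Qed.

Lemma derive_gram t v w y : U y ->
  'D_t (g v w) y = inner (u y) (B t v y) (X w y) + inner (u y) (B t w y) (X v y).
Proof.
move=> Uy; rewrite metric_compatible; last 3 first.
- exact: Du.1.
- exact: dX.
- exact: dX.
by rewrite XE !X2E [in X in _ + X]inner_sym.
Qed.

Lemma differentiable_gram v w y : U y -> differentiable (g v w) y.
Proof.
move=> Uy; apply: differentiable_sumE => a; apply: differentiable_sumE => b.
have dXa t i : differentiable (fun z => X t z 0 i) y by exact/differentiable_entry/dX.
apply: differentiableM; first exact: differentiableM.
exact: (differentiable_comp (Du.1 _ Uy) (Gdiff _ a b)).
Qed.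

Definition gram_det v1 v2 y := g v1 v1 y * g v2 v2 y - g v1 v2 y * g v1 v2 y.
Definition area_density v1 v2 y := Num.sqrt (gram_det v1 v2 y).
(** The component W^1 = a g^{1j} <d_{v0} u, d_{vj} u>, where a is the area density: g^{11} = g_22 /
    a^2 and g^{12} = - g_12 / a^2. Exchanging [v1] and [v2] gives W^2. *)
Definition flux v0 v1 v2 y :=
  (g v2 v2 y * g v0 v1 y - g v1 v2 y * g v0 v2 y) / area_density v1 v2 y.

(* With v1, v2 tangent to the surface and v0 the direction of variation, H v  *)
(* is <det(g) g^{ij} B_ij, v>, and the hypothesis on H says that the part of  *)
(* g^{ij} B_ij normal to the surface, the mean curvature, is orthogonal to v0.*)
Lemma first_variation v0 v1 v2 y : U y -> 0 < gram_det v1 v2 y ->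
  let ip Z v := inner (u y) Z (X v y) in
  let H v := g v2 v2 y * ip (B v1 v1 y) v - 2 * g v1 v2 y * ip (B v1 v2 y) v
             + g v1 v1 y * ip (B v2 v2 y) v in
  gram_det v1 v2 y * H v0 =
    H v1 * (g v2 v2 y * g v0 v1 y - g v1 v2 y * g v0 v2 y) +
    H v2 * (g v1 v1 y * g v0 v2 y - g v1 v2 y * g v0 v1 y) ->
  'D_v0 (area_density v1 v2) y =
  'D_v1 (flux v0 v1 v2) y + 'D_v2 (flux v0 v2 v1) y.
Proof.
move=> Uy D0 ip H Hmin.
have dg v w : differentiable (g v w) y by exact: differentiable_gram.
have gs v w z : g v w z = g w v z by exact: inner_sym.
have aE : area_density v2 v1 = area_density v1 v2.
  by apply/funext => z; rewrite /area_density /gram_det (gs v2 v1); congr Num.sqrt; ring.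
have fE : flux v0 v2 v1 = fun z =>
    (g v1 v1 z * g v0 v2 z - g v1 v2 z * g v0 v1 z) / area_density v1 v2 z.
  by apply/funext => z; rewrite /flux aE (gs v2 v1).
have dgg v w v' w' : differentiable (fun z => g v w z * g v' w' z) y.
  exact: differentiableM.
have dD : differentiable (gram_det v1 v2) y by exact: differentiableB.
have da : differentiable (area_density v1 v2) y by exact: differentiable_sqrt.
have a0 : area_density v1 v2 y != 0 by rewrite gt_eqF // sqrtr_gt0.
have DD t : 'D_t (gram_det v1 v2) y =
   'D_t (g v1 v1) y * g v2 v2 y + g v1 v1 y * 'D_t (g v2 v2) y
   - 2 * g v1 v2 y * 'D_t (g v1 v2) y.
  by rewrite derive_subE // !derive_mulE //; ring.
have Da t : 'D_t (area_density v1 v2) y =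
    'D_t (gram_det v1 v2) y / (2 * area_density v1 v2 y) by exact: derive_sqrt_comp.
have a2 : area_density v1 v2 y ^+ 2 = gram_det v1 v2 y by rewrite sqr_sqrtr // ltW.
rewrite fE /flux !derive_divE //; try exact: differentiableB.
rewrite !derive_subE // !derive_mulE // !Da !DD !derive_gram //.
have cs v w t : inner (u y) (B v w y) (X t y) = inner (u y) (B w v y) (X t y).
  by rewrite connection_torsion_free.
(* Torsion-freeness identifies the terms in nabla_{v1} d_{v0} u, produced by the divergence, with
   those in nabla_{v0} d_{v1} u, produced by the variation of the density; likewise for [v2]. *)
rewrite !(cs v1 v0) !(cs v2 v0) !(cs v2 v1).
move: Hmin a2; rewrite /H /ip {H ip}.
move: (area_density v1 v2 y) a0 => a a0; rewrite /gram_det.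
rewrite /g.
move: (inner _ (X v1 y) (X v1 y)) (inner _ (X v1 y) (X v2 y))
  (inner _ (X v2 y) (X v2 y)) (inner _ (X v0 y) (X v1 y))
  (inner _ (X v0 y) (X v2 y)) => E F K h1 h2.
do ![move: (inner _ (B _ _ _) _) => ?] => Hmin a2.
(* All inner products are now independent variables, and the identity is a linear consequence of
   [Hmin]. *)
apply: quotient_derivatives => //; rewrite a2; lra.
Qed.

End FirstVariation.

End LeviCivita.

(** * Vanishing mean curvature without denominators *)

Section MinimalSurface.
Context {R : realType} {n : nat} (G : 'rV[R]_n -> 'M[R]_n).
Implicit Types (u : 'rV[R]_2 -> 'rV[R]_n).

Lemma sum_ord2 (W : nmodType) (F : 'I_2 -> W) : \sum_i F i = F 0 + F 1.
Proof. by rewrite !big_ord_recl big_ord0 addr0; congr (_ + F _); exact/val_inj. Qed.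

Lemma ord2_case (i : 'I_2) : i = 0 \/ i = 1.
Proof. by case: i => [[|[|//]]] h; [left|right]; exact/val_inj. Qed.

Lemma det_mx2 (F : comPzRingType) (M : 'M[F]_2) :
  \det M = M 0 0 * M 1 1 - M 0 1 * M 1 0.
Proof.
rewrite (expand_det_row _ 0) sum_ord2 /cofactor !det_mx11 !mxE /= expr0 expr1.
rewrite mul1r mulN1r mulrN; congr (M _ _ * M _ _ - M _ _ * M _ _); exact/val_inj.
Qed.

Lemma invmx2E (F : fieldType) (M : 'M[F]_2) : \det M != 0 ->
  [/\ invmx M 0 0 = M 1 1 / \det M, invmx M 0 1 = - M 0 1 / \det M,
      invmx M 1 0 = - M 1 0 / \det M & invmx M 1 1 = M 0 0 / \det M].
Proof.
move=> d0; pose N : 'M[F]_2 := (\det M)^-1 *: \matrix_(i, j)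
  (if i == 0 then if j == 0 then M 1 1 else - M 0 1
   else if j == 0 then - M 1 0 else M 0 0).
suff -> : invmx M = N by split; rewrite !mxE /= mulrC.
have MU : M \in unitmx by rewrite unitmxE unitfE.
suff MN : M *m N = 1%:M by rewrite -[N](mulKmx MU) MN mulmx1.
rewrite det_mx2 in d0 *.
rewrite /N -scalemxAr det_mx2; apply/matrixP => i j.
rewrite mxE mxE sum_ord2 !mxE /=.
by have [->|->] := ord2_case i; have [->|->] := ord2_case j; rewrite /=; field.
Qed.

(** [H Y] is det g times the g-trace of <nabla_i d_j u, Y>. When the mean curvature vanishes, the
    trace of nabla_i d_j u is tangent to the surface, so its product with [Z] is recovered from its
    products with the two tangent vectors [X 0] and [X 1]. *)
Lemma mean_curvature_eq0 u x (Z : 'rV[R]_n) :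
  let g := pullback G u x in
  let X i := row i (jac u x) in
  let ip Y := inner G (u x) Y in
  let H Y := g 1 1 * ip (covd G u 0 0 x) Y - g 0 1 * ip (covd G u 0 1 x) Y
     - g 1 0 * ip (covd G u 1 0 x) Y + g 0 0 * ip (covd G u 1 1 x) Y in
  \det g != 0 -> mean_curvature G u x = 0 ->
  \det g * H Z = H (X 0) * (g 1 1 * ip (X 0) Z - g 0 1 * ip (X 1) Z) +
                 H (X 1) * (g 0 0 * ip (X 1) Z - g 1 0 * ip (X 0) Z).
Proof.
move=> g X ip H d0 mc0.
have [i00 i01 i10 i11] := invmx2E d0.
have ipD Y1 Y2 Y : ip (Y1 + Y2) Y = ip Y1 Y + ip Y2 Y.
  by rewrite /ip !innerE !mulmxDl mxE.
have ipN Y1 Y : ip (- Y1) Y = - ip Y1 Y.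
  by rewrite /ip !innerE !mulNmx mxE.
have ipZ c Y1 Y : ip (c *: Y1) Y = c * ip Y1 Y.
  by rewrite /ip !innerE -!scalemxAl mxE.
have ip0 Y : ip 0 Y = 0 by rewrite /ip innerE !mul0mx mxE.
have rowip Y i : (Y *m G (u x) *m (jac u x)^T) 0 i = ip Y (X i).
  by rewrite /ip innerE /X tr_row [RHS]mxE [LHS]mxE; apply: eq_bigr => a _; rewrite !mxE.
have ipt Y : ip (tangent_part G u x Y) Z =
    \sum_k \sum_l ip Y (X k) * invmx g k l * ip (X l) Z.
  have -> : tangent_part G u x Y = \sum_l (\sum_k ip Y (X k) * invmx g k l) *: X l.
    rewrite /tangent_part [LHS]mulmx_sum_row; apply: eq_bigr => l _.
    by rewrite mxE; congr (_ *: _); apply: eq_bigr => k _; rewrite rowip.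
  rewrite sum_ord2 ipD !ipZ exchange_big [RHS]sum_ord2.
  by congr (_ + _); rewrite mulr_suml.
have := congr1 (ip ^~ Z) mc0; rewrite ip0 /mean_curvature /second_fundamental_form.
rewrite !sum_ord2 !ipD !ipZ !ipD !ipN !ipt -/g !sum_ord2 i00 i01 i10 i11 /H.
move: (\det g) d0 (g 0 0) (g 0 1) (g 1 0) (g 1 1) => d d0 E F F' K.
do ![move: (ip _ _) => ?] => mc.
(* One factor [d] clears the inverse metric in the trace, the other the inverse metric in the
   tangential projection. *)
apply/eqP; rewrite -subr_eq0 -[X in _ == X](mulr0 (d ^+ 2)) -mc; apply/eqP.
by field.
Qed.

End MinimalSurface.

(** * The Fubini-Study metric in an affine chart *)

Section FubiniStudy.
Context {R : realType}.
Local Notation C := R[i].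
Implicit Types (p q v w d : 'rV[R]_4) (P Q : CP2 R).

(** [dot] and [omega] are the real and imaginary parts of the hermitian product of C^2, read on R^4
    ([herm_cvec]). *)
Definition dot p q : R :=
  \sum_(j < 2) (p 0 (@lshift 2 2 j) * q 0 (@lshift 2 2 j) +
                p 0 (@rshift 2 2 j) * q 0 (@rshift 2 2 j)).

Definition omega p q : R :=
  \sum_(j < 2) (p 0 (@rshift 2 2 j) * q 0 (@lshift 2 2 j) -
                p 0 (@lshift 2 2 j) * q 0 (@rshift 2 2 j)).

(** The classical expression of the Fubini-Study metric in affine coordinates, <v,w> / (1 + |p|^2) -
    Re(<v,p> <p,w>) / (1 + |p|^2)^2, with the real part of <v,w> in the first term. The index of the
    chart does not occur in it. *)
Definition fs p v w : R :=
  dot v w / (1 + dot p p) -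
  (dot v p * dot w p + omega v p * omega w p) / (1 + dot p p) ^+ 2.

Lemma dotDl p q v : dot (p + q) v = dot p v + dot q v.
Proof. by rewrite /dot -big_split; apply: eq_bigr => j _; rewrite !mxE /=; ring. Qed.

Lemma dotZl (c : R) p v : dot (c *: p) v = c * dot p v.
Proof. by rewrite /dot mulr_sumr; apply: eq_bigr => j _; rewrite !mxE /=; ring. Qed.

Lemma dotC p q : dot p q = dot q p.
Proof. by apply: eq_bigr => j _; ring. Qed.

Lemma omegaDl p q v : omega (p + q) v = omega p v + omega q v.
Proof. by rewrite /omega -big_split; apply: eq_bigr => j _; rewrite !mxE /=; ring. Qed.

Lemma omegaZl (c : R) p v : omega (c *: p) v = c * omega p v.
Proof. by rewrite /omega mulr_sumr; apply: eq_bigr => j _; rewrite !mxE /=; ring. Qed.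

Lemma omegaC p q : omega p q = - omega q p.
Proof. by rewrite /omega -sumrN; apply: eq_bigr => j _; ring. Qed.

Lemma dot_ge0 p : 0 <= dot p p.
Proof. by apply: sumr_ge0 => j _; rewrite -!expr2 addr_ge0 // sqr_ge0. Qed.

Lemma dot_eq0 p : (dot p p == 0) = (p == 0).
Proof.
apply/idP/eqP => [|->]; last by rewrite -[0](scale0r 0) dotZl mul0r.
rewrite psumr_eq0 => [|j _]; last by rewrite -!expr2 addr_ge0 // sqr_ge0.
move=> /allP p0; apply/rowP => a; rewrite mxE -(@splitK 2 2 a).
have H j : p 0 (@lshift 2 2 j) = 0 /\ p 0 (@rshift 2 2 j) = 0.
  have := p0 j (mem_index_enum j); rewrite -!expr2 paddr_eq0 ?sqr_ge0 // !sqrf_eq0.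
  by case/andP => /eqP-> /eqP->.
by case: (@fintype.split 2 2 a) => j /=; case: (H j).
Qed.

Lemma fsDl p v1 v2 w : fs p (v1 + v2) w = fs p v1 w + fs p v2 w.
Proof. by rewrite /fs !dotDl omegaDl; ring. Qed.

Lemma fsZl p c v w : fs p (c *: v) w = c * fs p v w.
Proof. by rewrite /fs !dotZl omegaZl; ring. Qed.

Lemma fsC p v w : fs p v w = fs p w v.
Proof. by rewrite /fs (dotC v w); ring. Qed.

Lemma hermC n (x z : 'rV[C]_n) : herm x z = (herm z x)^*.
Proof.
rewrite /herm rmorph_sum; apply: eq_bigr => j _.
by rewrite rmorphM /= conjCK mulrC.
Qed.

Lemma hermBl n (x y z : 'rV[C]_n) : herm (x - y) z = herm x z - herm y z.
Proof. by rewrite /herm -sumrB; apply: eq_bigr => j _; rewrite !mxE mulrBl. Qed.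

Lemma hermZl n (c : C) (x z : 'rV[C]_n) : herm (c *: x) z = c * herm x z.
Proof. by rewrite /herm mulr_sumr; apply: eq_bigr => j _; rewrite !mxE mulrA. Qed.

Lemma hermBr n (x y z : 'rV[C]_n) : herm z (x - y) = herm z x - herm z y.
Proof. by rewrite hermC hermBl rmorphB /= -!hermC. Qed.

Lemma hermZr n (c : C) (x z : 'rV[C]_n) : herm z (c *: x) = c^* * herm z x.
Proof. by rewrite hermC hermZl rmorphM /= -hermC. Qed.

Lemma herm_insert k (c c' : C) (w w' : 'rV[C]_2) :
  herm (insert_entry k c w) (insert_entry k c' w') = c * c'^* + herm w w'.
Proof.
rewrite /herm (bigD1_ord k) //= !mxE unlift_none; congr (_ + _).
by apply: eq_bigr => i _; rewrite !mxE liftK.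
Qed.

Lemma herm_cvec p q : herm (cvec p) (cvec q) = dot p q +i* omega p q.
Proof.
rewrite /herm /dot /omega !sum_ord2 !mxE; simpc.
by apply/eqP; rewrite eq_complex /=; apply/andP; split; apply/eqP; ring.
Qed.

Lemma cnorm_insert k p : cnorm (insert_entry k 1 (cvec p)) ^+ 2 = 1 + dot p p.
Proof.
apply: (@complexI R); rewrite -herm_cnorm herm_insert herm_cvec rmorph1 mulr1.
rewrite omegaC; apply/eqP; rewrite eq_complex /=; apply/andP; split; apply/eqP => //.
by have := omegaC p p; lra.
Qed.

(** For a unit vector z, the parts of x and y orthogonal to z have product <x,y> - <x,z> <z,y>. The
    inserted entry of a velocity is 0, so all these products reduce to products in C^2. *)
Lemma fubini_studyE k p a b :
  fubini_study k p a b = fs p (delta_mx 0 a) (delta_mx 0 b).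
Proof.
rewrite mxE; move: (delta_mx 0 a) (delta_mx 0 b) => v w.
have /eqP z1 := sphere_lift_S5 k p.
have := cnorm_insert k p; have := cnorm_insert_neq0 k (cvec p).
rewrite /hlift; set r := cnorm _ => r0 rE.
have zE : sphere_lift k p = r^-1%:C *: insert_entry k 1 (cvec p) by [].
have rr : r^-1%:C * (r^-1%:C)^* = (r ^- 2)%:C.
  by rewrite (CrealP _) ?complex_real // -rmorphM -expr2 exprVn.
have ipE v' : herm (r^-1%:C *: insert_entry k 0 (cvec v')) (sphere_lift k p) =
    (r ^- 2)%:C * (dot v' p +i* omega v' p).
  by rewrite zE hermZl hermZr herm_insert mul0r add0r herm_cvec mulrA rr.
have vwE : herm (r^-1%:C *: insert_entry k 0 (cvec v))
    (r^-1%:C *: insert_entry k 0 (cvec w)) = (r ^- 2)%:C * (dot v w +i* omega v w).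
  by rewrite hermZl hermZr herm_insert mul0r add0r herm_cvec mulrA rr.
move: (sphere_lift k p) z1 (_ *: _) (_ *: _) (ipE v) (ipE w) vwE.
move=> z z1 x y xz yz xy.
rewrite hermBl !hermBr !hermZl !hermZr z1 (hermC z) xy xz yz.
rewrite /fs -rE -(exprVn (r ^+ 2)); move: (r ^- 2) => c.
by rewrite mulr1 [X in _ - X]subrr subr0; simpc => /=; ring.
Qed.

Lemma inner_fubini_study k p v w : inner (fubini_study k) p v w = fs p v w.
Proof.
have E v' w' : fs p v' w' =
    \sum_a \sum_b v' 0 a * w' 0 b * fs p (delta_mx 0 a) (delta_mx 0 b).
  have sl (I : finType) (x : I -> 'rV[R]_4) y :
      fs p (\sum_i x i) y = \sum_i fs p (x i) y.
    elim/big_ind2 : _ => [|x1 x2 y1 y2 <- <-|//]; last by rewrite fsDl.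
    by rewrite -[0](scale0r 0) fsZl mul0r.
  rewrite {1}[v']row_sum_delta sl; apply: eq_bigr => a _.
  rewrite fsC {1}[w']row_sum_delta sl; apply: eq_bigr => b _.
  by rewrite fsZl fsC fsZl; ring.
by rewrite E; apply: eq_bigr => a _; apply: eq_bigr => b _; rewrite fubini_studyE.
Qed.

Lemma one_dot_gt0 p : 0 < 1 + dot p p.
Proof. by rewrite ltr_pwDl ?ltr01 ?dot_ge0. Qed.

(* The squared norm of the bivector (1, p) /\ (0, v) of C^3. *)
Definition bivector p v : R :=
  dot v v * (1 + dot p p) - dot v p ^+ 2 - omega v p ^+ 2.

Lemma fs_bivector p v : fs p v v = bivector p v / (1 + dot p p) ^+ 2.
Proof. by rewrite /fs /bivector; field; rewrite gt_eqF ?one_dot_gt0. Qed.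

(** Expanding gives |v|^2 plus the defect in the Cauchy-Schwarz inequality of C^2, which is
    nonnegative. *)
Lemma bivector_gt0 p v : v != 0 -> 0 < bivector p v.
Proof.
rewrite -dot_eq0 => v0; have vp : 0 < dot v v by rewrite lt_def v0 dot_ge0.
suff : 0 <= dot v v * dot p p - dot v p ^+ 2 - omega v p ^+ 2.
  by rewrite /bivector mulrDr mulr1; lra.
rewrite /dot /omega !sum_ord2.
set a1 := v 0 (@lshift 2 2 0); set b1 := v 0 (@rshift 2 2 0).
set a2 := v 0 (@lshift 2 2 1); set b2 := v 0 (@rshift 2 2 1).
set c1 := p 0 (@lshift 2 2 0); set d1 := p 0 (@rshift 2 2 0).
set c2 := p 0 (@lshift 2 2 1); set d2 := p 0 (@rshift 2 2 1).
(* Lagrange's identity: the defect is |v_1 p_2 - v_2 p_1|^2, and the two squares are those of its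
   real and imaginary parts. *)
have -> : (a1 * a1 + b1 * b1 + (a2 * a2 + b2 * b2)) *
    (c1 * c1 + d1 * d1 + (c2 * c2 + d2 * d2)) -
    (a1 * c1 + b1 * d1 + (a2 * c2 + b2 * d2)) ^+ 2 -
    (b1 * c1 - a1 * d1 + (b2 * c2 - a2 * d2)) ^+ 2 =
  (a1 * c2 - b1 * d2 - a2 * c1 + b2 * d1) ^+ 2 +
  (a1 * d2 + b1 * c2 - a2 * d1 - b2 * c1) ^+ 2 by ring.
by rewrite addr_ge0 // sqr_ge0.
Qed.

Lemma fs_gt0 p v : v != 0 -> 0 < fs p v v.
Proof. by move=> v0; rewrite fs_bivector divr_gt0 ?bivector_gt0 // exprn_gt0 // one_dot_gt0. Qed.

End FubiniStudy.

(** * Independence of the chart *)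

Section Regularity.
Context {R : realType} {V : normedModType R} (k : nat) (U : set V).
Hypothesis oU : open U.
Implicit Types X Y Z : V -> 'rV[R]_4.

Lemma differentiable_times_dot X Y :
  differentiable_times k U X -> differentiable_times k U Y ->
  differentiable_times k U (fun y => dot (X y) (Y y)).
Proof.
move=> DX DY; apply: differentiable_times_sum => // j.
by apply: differentiable_timesD => //; apply: differentiable_timesM => //;
  exact: differentiable_times_coord.
Qed.

Lemma differentiable_times_omega X Y :
  differentiable_times k U X -> differentiable_times k U Y ->
  differentiable_times k U (fun y => omega (X y) (Y y)).
Proof.
move=> DX DY; apply: differentiable_times_sum => // j.
by apply: differentiable_timesB => //; apply: differentiable_timesM => //;
  exact: differentiable_times_coord.
Qed.

Lemma differentiable_times_fs X Y Z :
  differentiable_times k U X -> differentiable_times k U Y ->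
  differentiable_times k U Z ->
  differentiable_times k U (fun y => fs (X y) (Y y) (Z y)).
Proof.
move=> DX DY DZ.
have DN : differentiable_times k U (fun y => 1 + dot (X y) (X y)).
  apply: differentiable_timesD => //; last exact: differentiable_times_dot.
  exact: differentiable_times_cst.
have N0 x : U x -> 1 + dot (X x) (X x) != 0 by move=> _; rewrite gt_eqF ?one_dot_gt0.
have DNV := differentiable_timesV oU N0 DN.
have DNV2 : differentiable_times k U (fun y => ((1 + dot (X y) (X y)) ^+ 2)^-1).
  have := differentiable_timesM oU DNV DNV.
  by apply: differentiable_times_eq => // y _; rewrite -exprVn.
apply: differentiable_timesB => //; apply: differentiable_timesM => //.
  exact: differentiable_times_dot.
by apply: differentiable_timesD => //; apply: differentiable_timesM => //;
  first [exact: differentiable_times_dot | exact: differentiable_times_omega].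
Qed.

End Regularity.

Lemma differentiable_times_id {R : realType} {V : normedModType R} k (U : set V) :
  differentiable_times k U id.
Proof.
case: k => [|k]; first by move=> x _; exact: cvg_id.
split=> [x _|v]; first by [].
have -> : 'D_v (id : V -> V) = cst v by apply/funext => x; exact: derive_id.
exact: differentiable_times_cst.
Qed.

Section ChartIndependence.
Context {R : realType}.
Local Notation C := R[i].
Implicit Types (P Q : CP2 R) (p q : 'rV[R]_4).

Definition normsq (z : C) : R := complex.Re z ^+ 2 + complex.Im z ^+ 2.

Lemma normsqM z w : normsq (z * w) = normsq z * normsq w.
Proof. by case: z w => [a b] [c d]; rewrite /normsq; simpc => /=; ring. Qed.

Lemma normsq_conj z : normsq z^* = normsq z.
Proof. by case: z => a b; rewrite /normsq /= sqrrN. Qed.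

Lemma mulc_conj (z : C) : z * z^* = (normsq z)%:C.
Proof.
case: z => a b; transitivity ((a * a - b * - b) +i* (a * - b + b * a)) => //.
by rewrite /normsq; congr (_ +i* _) => /=; ring.
Qed.

Lemma cvecK (w : 'rV[C]_2) : cvec (rvec w) = w.
Proof.
apply/rowP => j; rewrite mxE /rvec (@row_mxEl _ 1 2 2) (@row_mxEr _ 1 2 2) !mxE.
by case: (w 0 j).
Qed.

Lemma rep_chart k P : in_chart k P ->
  rep P = rep P 0 k *: insert_entry k 1 (cvec (chart k P)).
Proof.
rewrite /in_chart => r0; apply/rowP => j; rewrite !mxE cvecK.
case: unliftP => [i ->|->]; last by rewrite mulr1.
by rewrite mxE mulrCA divff // mulr1.
Qed.

Lemma normsq_rep k P : in_chart k P ->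
  normsq (rep P 0 k) = (1 + dot (chart k P) (chart k P))^-1.
Proof.
move=> kP; have /eqP : in_S5 (rep P) by exact: valP.
rewrite {1 2}(rep_chart kP) hermZl hermZr mulrA mulc_conj herm_cnorm cnorm_insert.
rewrite -rmorphM /= => /(@complexI R) /(canRL (mulfK _)) -> //.
  by rewrite mul1r.
by rewrite gt_eqF ?one_dot_gt0.
Qed.

(** The squared sine of the Fubini-Study distance. No chart enters the definition, so its
    infinitesimal behaviour can be compared between charts. *)
Definition chordal P Q : R := 1 - normsq (herm (rep P) (rep Q)).

(** For Z = (1, p) and W = (1, q) the value is |Z /\ W|^2 / (|Z|^2 |W|^2), and Z /\ W = (1, p) /\
    (0, q - p). *)
Lemma chordalE k P Q : in_chart k P -> in_chart k Q ->
  let p := chart k P in let q := chart k Q in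
  chordal P Q = bivector p (q - p) / ((1 + dot p p) * (1 + dot q q)).
Proof.
move=> kP kQ p q; rewrite /chordal (rep_chart kP) (rep_chart kQ).
rewrite hermZl hermZr !normsqM normsq_conj !normsq_rep // -/p -/q.
rewrite herm_insert rmorph1 mul1r herm_cvec.
have -> : normsq (1 + (dot p q +i* omega p q)) = (1 + dot p q) ^+ 2 + omega p q ^+ 2.
  by rewrite /normsq /= add0r.
have [d ->] : exists d, q = d + p by exists (q - p); rewrite subrK.
rewrite addrK /bivector ![dot p (_ + _)]dotC ![omega p (_ + _)]omegaC !dotDl !omegaDl.
have p0 : omega p p = 0 by have := omegaC p p; lra.
have := one_dot_gt0 p; have := one_dot_gt0 (d + p).
rewrite !dotDl ![dot _ (d + p)]dotC !dotDl (dotC p d) p0.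
by move=> N1 N2; field; rewrite !gt_eqF.
Qed.

Context {V : normedModType R}.

(** [bivector] is quadratic in its second argument, so dividing by s^2 turns the increment of the
    chart coordinates into a difference quotient, which tends to the derivative. *)
Lemma chordal_limit k (F : V -> CP2 R) y v :
  (\forall z \near y, in_chart k (F z)) ->
  differentiable (fun z => chart k (F z)) y ->
  let u z := chart k (F z) in
  (fun s : R => s ^- 2 * chordal (F y) (F (s *: v + y))) @ 0^' -->
    fs (u y) ('D_v u y) ('D_v u y).
Proof.
move=> Fk du u.
have ky : in_chart k (F y) by exact: nbhs_singleton Fk.
have line : s *: v + y @[s --> (0:R)^'] --> y.
  have : s *: v + y @[s --> (0 : R)] --> 0 *: v + y.
    by apply: cvgD; [apply: cvgZ; [exact: cvg_id|exact: cvg_cst]|exact: cvg_cst].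
  by rewrite scale0r add0r; exact: cvg_within_filter.
have idT k' := @differentiable_times_id R _ k' [set: 'rV[R]_4].
have cstT k' p := @differentiable_times_cst R _ _ k' [set: 'rV[R]_4] (p : 'rV[R]_4).
have cdot p : {for p, continuous (fun q => 1 + dot q q)}.
  apply: continuousD; first exact: cst_continuous.
  by apply: (differentiable_times_dot (k := 0) openT (idT 0) (idT 0)).
have cbiv p q : {for q, continuous (fun d => bivector p d)}.
  have D1 := differentiable_times_dot openT (idT 0%N) (idT 0%N).
  have D2 := differentiable_times_dot openT (idT 0%N) (cstT 0%N p).
  have D3 := differentiable_times_omega openT (idT 0%N) (cstT 0%N p).
  have DN := differentiable_times_cst 0 [set: 'rV[R]_4] (1 + dot p p).
  exact: (differentiable_timesB openT (differentiable_timesB openT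
    (differentiable_timesM openT D1 DN) (differentiable_timesM openT D2 D2))
    (differentiable_timesM openT D3 D3)).
have cN : 1 + dot (u (s *: v + y)) (u (s *: v + y)) @[s --> (0:R)^'] -->
    1 + dot (u y) (u y).
  have cu : u (s *: v + y) @[s --> (0:R)^'] --> u y.
    have := differentiable_continuous du; exact: cvg_comp.
  exact: (cvg_comp _ _ cu (cdot (u y))).
have cD : s^-1 *: (u (s *: v + y) - u y) @[s --> (0:R)^'] --> 'D_v u y.
  exact: (diff_derivable du).
have cB : bivector (u y) (s^-1 *: (u (s *: v + y) - u y)) @[s --> (0:R)^'] -->
    bivector (u y) ('D_v u y).
  exact: (cvg_comp _ _ cD (cbiv _ _)).
have N0 := one_dot_gt0 (u y).
have NN : (1 + dot (u y) (u y)) * (1 + dot (u y) (u y)) != 0.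
  by rewrite mulf_neq0 // gt_eqF.
rewrite fs_bivector expr2.
have lineF : \forall s \near (0:R)^', in_chart k (F (s *: v + y)) by exact: (line _ Fk).
have E : \forall s \near (0:R)^',
    bivector (u y) (s^-1 *: (u (s *: v + y) - u y)) /
    ((1 + dot (u y) (u y)) * (1 + dot (u (s *: v + y)) (u (s *: v + y)))) =
    s ^- 2 * chordal (F y) (F (s *: v + y)).
  near=> s.
  have s0 : s != 0 by near: s; exact: nbhs_dnbhs_neq.
  have sF : in_chart k (F (s *: v + y)) by near: s.
  rewrite (chordalE ky sF) -/(u y) -/(u (s *: v + y)) mulrA; congr (_ / _).
  by rewrite /bivector !dotZl dotC dotZl omegaZl; field.
apply: (cvg_trans (near_eq_cvg E)); apply: cvgM => //; apply: cvgV => //.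
by apply: cvgM => //; exact: cvg_cst.
Unshelve. all: by end_near. Qed.

End ChartIndependence.

Section VectorValued.
Context {R : realType} {V : normedModType R} (k : nat) (U : set V).
Hypothesis oU : open U.

Lemma differentiable_times_scale (W : normedModType R) k' (f : V -> R) (c : W) :
  differentiable_times k' U f -> differentiable_times k' U (fun x => f x *: c).
Proof.
elim: k' f => [|m IH] f /=.
  by move=> cf x Ux; apply: cvgZ; [exact: cf|exact: cvg_cst].
move=> [df cf]; split=> [x Ux|v].
  by apply: differentiableZl; exact: df.
apply: differentiable_times_eq (IH _ (cf v)) => // x; rewrite inE => Ux.
have dfx := df _ Ux.
rewrite [RHS]deriveE; last exact: differentiableZl.
by rewrite diffZl // deriveE.
Qed.

Lemma differentiable_times_row n (f : 'I_n -> V -> R) :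
  (forall i, differentiable_times k U (f i)) ->
  differentiable_times k U (fun x => \row_i f i x).
Proof.
move=> Df.
have H m (h : 'I_m -> 'I_n) :
    differentiable_times k U (fun x => \sum_(i < m) f (h i) x *: delta_mx (0:'I_1) (h i)).
  elim: m h => [|m IH] h.
    have := differentiable_times_cst k U (0 : 'rV[R]_n).
    by apply: differentiable_times_eq => // x _; rewrite big_ord0.
  have := differentiable_timesD oU (differentiable_times_scale (delta_mx (0:'I_1) (h ord0)) (Df (h ord0)))
    (IH (fun i => h (lift ord0 i))).
  by apply: differentiable_times_eq => // x _; rewrite big_ord_recl.
have := H n id; apply: differentiable_times_eq => // x _.
by rewrite [RHS]row_sum_delta; apply: eq_bigr => i _; rewrite mxE.
Qed.

End VectorValued.

Lemma open_neq0 {R : realType} {V : normedModType R} (U : set V) (f : V -> R) :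
  open U -> {in U, continuous f} -> open (U `&` [set x | f x != 0]).
Proof.
move=> oU cf; rewrite openE => x [Ux fx0].
have nU := open_nbhs_nbhs (conj oU Ux).
have nf : \forall y \near x, f y != 0.
  have := cf x (mem_set Ux).
  by move=> /cvgr_neq0 -/(_ fx0).
by apply: filterS2 nU nf => y ? ?.
Qed.

(** * Change of chart *)

Section Charts.
Context {R : realType} {V : normedModType R}.
Local Notation C := R[i].
Implicit Types (F : V -> CP2 R) (A : set V).

Lemma fs_polarization p q (f g : {linear V -> 'rV[R]_4}) :
  (forall t, fs p (f t) (f t) = fs q (g t) (g t)) ->
  forall v w, fs p (f v) (f w) = fs q (g v) (g w).
Proof.
move=> Q v w.
have P (c a b : 'rV[R]_4) : fs c a b = 2^-1 * (fs c (a + b) (a + b) - fs c a a - fs c b b).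
  by rewrite !fsDl !(fsC c _ (a + b)) !fsDl (fsC c b a); field.
by rewrite (P p) (P q) -!linearD !Q.
Qed.

(** In either chart the squared length of the velocity is the limit of the same chordal quotients,
    and limits are unique. Polarization extends the equality to inner products, so the transition
    map is never differentiated. *)
Lemma fs_chart_independent k l F (uk ul : V -> 'rV[R]_4) y v w :
  uk = (fun z => chart k (F z)) -> ul = (fun z => chart l (F z)) ->
  (\forall z \near y, in_chart k (F z)) -> differentiable uk y ->
  (\forall z \near y, in_chart l (F z)) -> differentiable ul y ->
  fs (uk y) ('D_v uk y) ('D_w uk y) = fs (ul y) ('D_v ul y) ('D_w ul y).
Proof.
move=> Ek El nk dk nl dl.
have Q t : fs (uk y) ('D_t uk y) ('D_t uk y) = fs (ul y) ('D_t ul y) ('D_t ul y).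
  rewrite Ek in dk *; rewrite El in dl *.
  have ck := chordal_limit (v := t) nk dk; have cl := chordal_limit (v := t) nl dl.
  exact: (cvg_unique (@norm_hausdorff _ R^o) ck cl).
rewrite (deriveE v dk) (deriveE w dk) (deriveE v dl) (deriveE w dl).
have Q' t : fs (uk y) ('d uk y t) ('d uk y t) = fs (ul y) ('d ul y t) ('d ul y t).
  by have := Q t; rewrite (deriveE t dk) (deriveE t dl).
exact: (fs_polarization Q').
Qed.

Definition hom_coord k (p : 'rV[R]_4) (j : 'I_3) : C := insert_entry k 1 (cvec p) 0 j.

Lemma rep_hom_coord l P j : in_chart l P ->
  rep P 0 j = rep P 0 l * hom_coord l (chart l P) j.
Proof. by move=> lP; rewrite {1}(rep_chart lP) mxE. Qed.

Lemma in_chart_change k l P : in_chart l P ->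
  in_chart k P = (normsq (hom_coord l (chart l P) k) != 0).
Proof.
move=> lP; have r0 : rep P 0 l != 0 := lP.
rewrite {1}/in_chart (rep_hom_coord k lP) mulf_eq0 (negPf r0) orFb; congr (~~ _).
case: (hom_coord _ _ _) => a b; rewrite eq_complex /normsq /=.
by rewrite paddr_eq0 ?sqr_ge0 // !sqrf_eq0.
Qed.

Lemma chart_change k l P : in_chart l P ->
  chart k P = rvec (\row_i (hom_coord l (chart l P) (lift k i) /
                            hom_coord l (chart l P) k)).
Proof.
move=> lP; have r0 : rep P 0 l != 0 := lP.
have := fun j => rep_hom_coord j lP; move: (hom_coord l _) => h E.
have -> : chart k P = rvec (\row_i (rep P 0 (lift k i) / rep P 0 k)) by [].
apply: congr1.
apply/rowP => i.
rewrite [LHS]mxE.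
rewrite [RHS]mxE.
rewrite (E (lift k i)) (E k).
by rewrite -mulf_div divff // mul1r.
Qed.

Lemma rvec_div (z : 'I_2 -> C) (w : C) :
  rvec (\row_i (z i / w)) = \row_(a < 2 + 2)
    match @fintype.split 2 2 a with
    | inl i => (complex.Re (z i) * complex.Re w + complex.Im (z i) * complex.Im w) / normsq w
    | inr i => (complex.Im (z i) * complex.Re w - complex.Re (z i) * complex.Im w) / normsq w
    end.
Proof.
apply/rowP => a; rewrite !mxE; case: (@fintype.split 2 2 a) => i; rewrite !mxE.
  by case: (z i) w => s t [c d]; rewrite /normsq /=; ring.
by case: (z i) w => s t [c d]; rewrite /normsq /=; ring.
Qed.

(** [smooth_map] provides some chart only. Any other chart around [F x] is reached by a rational
    map, whose real components [rvec_div] writes with denominator |w|^2. *)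
Lemma smooth_map_chart A F x k : smooth_map A F -> A x -> in_chart k (F x) ->
  exists U (g : V -> 'rV[R]_4), [/\ U x, smooth U g &
    forall y, A y -> U y -> in_chart k (F y) /\ chart k (F y) = g y].
Proof.
move=> sF Ax kx; have [l [U [g [Ux [oU Dg] Fg]]]] := sF x Ax.
pose re j y := complex.Re (hom_coord l (g y) j).
pose im j y := complex.Im (hom_coord l (g y) j).
have Dre j m : differentiable_times m U (re j).
  rewrite /re; case: (unliftP l j) => [i ->|->].
    have := differentiable_times_coord 0 (@lshift 2 2 i) oU (Dg m).
    by apply: differentiable_times_eq => // y _; rewrite /hom_coord mxE liftK mxE.
  have := differentiable_times_cst m U (1 : R).
  by apply: differentiable_times_eq => // y _; rewrite /hom_coord mxE unlift_none.
have Dim j m : differentiable_times m U (im j).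
  rewrite /im; case: (unliftP l j) => [i ->|->].
    have := differentiable_times_coord 0 (@rshift 2 2 i) oU (Dg m).
    by apply: differentiable_times_eq => // y _; rewrite /hom_coord mxE liftK mxE.
  have := differentiable_times_cst m U (0 : R).
  by apply: differentiable_times_eq => // y _; rewrite /hom_coord mxE unlift_none.
pose nk y := normsq (hom_coord l (g y) k).
have Dnk m : differentiable_times m U nk.
  have := differentiable_timesD oU (differentiable_timesM oU (Dre k m) (Dre k m))
    (differentiable_timesM oU (Dim k m) (Dim k m)).
  by apply: differentiable_times_eq => // y _; rewrite /nk /normsq !expr2.
(* Where [nk] does not vanish, the extension [g] stays in the domain of the transition map, also at
   points outside [A]. *)
pose U' := U `&` [set y | nk y != 0].
have oU' : open U'.
  by apply: open_neq0 => // y /set_mem; exact: (Dnk 0%N).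
have sub : U' `<=` U by move=> y [].
exists U', (fun y => rvec (\row_i (hom_coord l (g y) (lift k i) / hom_coord l (g y) k))).
split.
- split=> //=; have [lx gx] := Fg x Ax Ux.
  by rewrite /nk -gx -in_chart_change.
- split=> // m.
  have -> : (fun y => rvec (\row_i (hom_coord l (g y) (lift k i) / hom_coord l (g y) k))) =
    fun y => \row_(a < 2 + 2) match @fintype.split 2 2 a with
    | inl i => (re (lift k i) y * re k y + im (lift k i) y * im k y) / nk y
    | inr i => (im (lift k i) y * re k y - re (lift k i) y * im k y) / nk y
    end.
    by apply/funext => y; rewrite rvec_div.
  have D h := differentiable_times_sub (k := m) (f := h) sub.
  have DV : differentiable_times m U' (fun y => (nk y)^-1).
    by apply: differentiable_timesV => //; [move=> y []|exact: D].
  apply: differentiable_times_row => // a; case: (@fintype.split 2 2 a) => i.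
    apply: differentiable_timesM => //; apply: differentiable_timesD => //.
      by apply: differentiable_timesM => //; exact: D.
    by apply: differentiable_timesM => //; exact: D.
  apply: differentiable_timesM => //; apply: differentiable_timesB => //.
    by apply: differentiable_timesM => //; exact: D.
  by apply: differentiable_timesM => //; exact: D.
- move=> y Ay [Uy ky]; have [ly gy] := Fg y Ay Uy.
  split; last by rewrite (chart_change k ly) gy.
  by rewrite (in_chart_change k ly) gy.
Qed.

End Charts.

(** * Integration over the unit square *)

Section Square.
Context {R : realType}.
Local Notation mu := (@lebesgue_measure R).
Implicit Types (f g : R * R -> R).

(** An open set is the union of the rectangles with rational endpoints that it contains, of which
    there are countably many. *)
Lemma open_prod_measurable (O : set (R * R)) : open O -> measurable O.
Proof.
move=> oO.
pose rect (q : (rat * rat) * (rat * rat)) : set (R * R) :=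
  `](ratr q.1.1 : R), ratr q.1.2[ `*` `](ratr q.2.1 : R), ratr q.2.2[.
have -> : O = \bigcup_q (if `[< rect q `<=` O >] then rect q else set0).
  apply/seteqP; split => [[x y] Oxy|z [q _]]; last by case: ifPn => // /asboolP; exact.
  have /nbhs_ballP[e /= e0 eO] := open_nbhs_nbhs (conj oO Oxy).
  have itv (t : R) : exists q : rat * rat, (ratr q.1 < t < ratr q.2) /\
      forall s : R, ratr q.1 < s < ratr q.2 -> ball t e s.
    have [a] : exists q, ratr q \in `](t - e), t[ by apply: rat_in_itvoo; rewrite ltrBlDr ltrDl.
    have [b] : exists q, ratr q \in `]t, (t + e)[ by apply: rat_in_itvoo; rewrite ltrDl.
    rewrite !in_itv /= => /andP[tb be] /andP[ea at_].
    exists (a, b); rewrite /= tb at_; split => // s /andP[as_ sb].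
    rewrite /ball /= ltr_distlC; lra.
  have [qx [xq qxe]] := itv x; have [qy [yq qye]] := itv y.
  exists (qx, qy) => //; rewrite ifT; first by split.
  apply/asboolP => -[s t] [/=]; rewrite !in_itv /= => sx ty.
  by apply: eO; split; [exact: qxe|exact: qye].
apply: countable_bigcupT_measurable; first exact: countableP.
move=> q; case: ifPn => // _; exact: measurableX.
Qed.

Lemma continuous_prod_measurable f : continuous f -> measurable_fun setT f.
Proof.
move=> /continuousP cf; apply: (measurability _ (measurable_realfun.RGenOpens.measurableE R)).
move=> _ [_ [a [b ->] <-]]; rewrite setTI; apply: open_prod_measurable.
exact/cf/interval_open.
Qed.

Definition unit_square : set (R * R) := `[0, 1] `*` `[0, 1].

Lemma measurable_unit_square :
  measurable (unit_square : set (measurableTypeR R * measurableTypeR R)).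
Proof. exact: measurableX. Qed.

Lemma unit_square_measure : (mu \x mu)%E unit_square = 1%E.
Proof.
have m01 : mu `[0%R, 1%R]%classic = 1%E.
  by have := lebesgue_measure_itv (`[0%R : R, 1%R]); rewrite /= lte_fin ltr01 -EFinB subr0.
rewrite product_measure1E //; transitivity (1 * 1 : \bar R)%E; last by rewrite mule1.
exact: (congr2 *%E).
Qed.

Lemma compact_unit_square : compact unit_square.
Proof. by apply: compact_setX; exact: segment_compact. Qed.

Lemma integrable_unit_square f : continuous f ->
  (mu \x mu)%E.-integrable unit_square (EFin \o f).
Proof.
move=> cf; apply: measurable_bounded_integrable.
- exact: measurable_unit_square.
- suff : ((mu \x mu)%E unit_square < +oo)%E by [].
  by rewrite unit_square_measure ltry.
- have mf := continuous_prod_measurable cf.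
  apply: measurable_funTS.
  exact: mf.
- have cA : {within unit_square, continuous f} by exact: continuous_subspaceT.
  have /compact_bounded := continuous_compact cA compact_unit_square.
  rewrite /bounded_set /bounded_near; apply: filterS => M HM x Qx.
  by apply: HM; exists x.
Qed.

Definition square_integral f : R := \int[(mu \x mu)%E]_(p in unit_square) f p.

Lemma square_integralE f : continuous f ->
  (\int[mu \x mu]_(p in unit_square) (f p)%:E)%E = (square_integral f)%:E.
Proof.
move=> cf; rewrite /square_integral /Rintegral fineK //.
by apply: integrable_fin_num; [exact: measurable_unit_square|exact: integrable_unit_square].
Qed.

Lemma square_integralB f g : continuous f -> continuous g ->
  square_integral (fun p => f p - g p) = square_integral f - square_integral g.
Proof.
move=> cf cg; apply: RintegralB; first exact: measurable_unit_square.
  exact: integrable_unit_square.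
exact: integrable_unit_square.
Qed.

Lemma square_integralD f g : continuous f -> continuous g ->
  square_integral (fun p => f p + g p) = square_integral f + square_integral g.
Proof.
move=> cf cg; apply: RintegralD; first exact: measurable_unit_square.
  exact: integrable_unit_square.
exact: integrable_unit_square.
Qed.

Lemma square_integralZ (c : R) f : continuous f ->
  square_integral (fun p => c * f p) = c * square_integral f.
Proof.
move=> cf; apply: RintegralZl; first exact: measurable_unit_square.
exact: integrable_unit_square.
Qed.

Lemma square_integral_le f (e : R) : continuous f ->
  (forall p, unit_square p -> `|f p| <= e) -> `|square_integral f| <= e.
Proof.
move=> cf fe; have cn : continuous (fun p => `|f p|).
  by move=> p; apply: continuous_comp; [exact: cf|exact: norm_continuous].
have h1 := le_normr_Rintegral measurable_unit_square (integrable_unit_square cf).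
apply: (le_trans h1).
have ie : (mu \x mu)%E.-integrable unit_square (EFin \o cst e).
  by apply: integrable_unit_square; exact: cst_continuous.
have h2 := le_Rintegral measurable_unit_square (integrable_unit_square cn) ie fe.
apply: (le_trans h2).
have E := @Rintegral_cst _ _ _ (mu \x mu)%E _ measurable_unit_square e.
have -> : \int[(mu \x mu)%E]_(x in unit_square) cst e x = e; last by [].
rewrite E -[RHS]mulr1; congr (_ * _).
have -> : 1 = fine (1%E : \bar R) by [].
by apply: congr1; exact: unit_square_measure.
Qed.

Lemma segment_FTC (g h : R -> R) : (forall t : R, is_derive t 1 h (g t)) ->
  continuous g -> (\int[mu]_(x in `[0%R, 1%R]) (g x)%:E = (h 1)%:E - (h 0)%:E)%E.
Proof.
move=> dh cg.
have ch : continuous h.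
  by move=> t; apply: differentiable_continuous; apply/derivable1_diffP; case: (dh t).
apply: continuous_FTC2; first by rewrite ltr01.
- exact: continuous_subspaceT.
- split; first by move=> t _; case: (dh t).
  + exact/cvg_at_right_filter/ch.
  + exact/cvg_at_left_filter/ch.
- by move=> t _; rewrite derive1E; case: (dh t).
Qed.

Lemma pair_continuous (y x : R) : {for x, continuous (fun x : R => (x, y))}.
Proof.
by apply: (@differentiable_continuous _ R^o (R^o * R^o)%type); apply: differentiable_pair.
Qed.

Lemma pair_continuousr (x y : R) : {for y, continuous (fun y : R => (x, y))}.
Proof.
by apply: (@differentiable_continuous _ R^o (R^o * R^o)%type); apply: differentiable_pair.
Qed.

(** Integrate in [x] first: the inner integral is w(1, y) - w(0, y), which periodicity makes 0. *)
Lemma square_integral_dx f (w : R * R -> R) : continuous f ->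
  (forall x y : R, is_derive x 1 (fun t : R => w (t, y)) (f (x, y))) ->
  (forall y, w (1, y) = w (0, y)) -> square_integral f = 0.
Proof.
move=> cf dw per.
rewrite /square_integral /Rintegral integral_mkcond.
(* Fubini's theorem is applied on the whole plane, to the integrand extended by 0 outside the
   square. *)
have int : (mu \x mu)%E.-integrable setT ((EFin \o f) \_ unit_square).
  rewrite -integrable_mkcond; first exact: integrable_unit_square.
  exact: measurable_unit_square.
rewrite -(integral21_prod_meas1 int) integral0_eq // => y _; rewrite /fubini_G.
have [y01|y01] := boolP (y \in `[0%R, 1%R]); last first.
  rewrite integral0_eq // => x _; rewrite patchE ifF //.
  by apply/negP => /set_mem[_ /=]; apply/negP.
transitivity (\int[mu]_(x in `[0%R, 1%R]) (f (x, y))%:E)%E.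
  rewrite [RHS]integral_mkcond; apply: eq_integral => x _; rewrite !patchE.
  have -> : ((x, y) \in unit_square) = (x \in `[0%R, 1%R]%classic); last by [].
  by apply/idP/idP => /set_mem H; apply/mem_set; [case: H|split].
have cg : continuous (fun x => f (x, y)).
  move=> x; apply: (@continuous_comp _ _ _ (fun x => (x, y)) f); last exact: cf.
  exact: pair_continuous.
by rewrite (segment_FTC (fun x => dw x y) cg) per subee.
Qed.

Lemma square_integral_dy f (w : R * R -> R) : continuous f ->
  (forall x y : R, is_derive y 1 (fun t : R => w (x, t)) (f (x, y))) ->
  (forall x, w (x, 1) = w (x, 0)) -> square_integral f = 0.
Proof.
move=> cf dw per.
rewrite /square_integral /Rintegral integral_mkcond.
have int : (mu \x mu)%E.-integrable setT ((EFin \o f) \_ unit_square).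
  rewrite -integrable_mkcond; first exact: integrable_unit_square.
  exact: measurable_unit_square.
rewrite -(integral12_prod_meas1 int) integral0_eq // => x _; rewrite /fubini_F.
have [x01|x01] := boolP (x \in `[0%R, 1%R]); last first.
  rewrite integral0_eq // => y _; rewrite patchE ifF //.
  by apply/negP => /set_mem[/= h _]; move: h; apply/negP.
transitivity (\int[mu]_(y in `[0%R, 1%R]) (f (x, y))%:E)%E.
  rewrite [RHS]integral_mkcond; apply: eq_integral => y _; rewrite !patchE.
  have -> : ((x, y) \in unit_square) = (y \in `[0%R, 1%R]%classic); last by [].
  by apply/idP/idP => /set_mem H; apply/mem_set; [case: H|split].
have cg : continuous (fun y => f (x, y)).
  move=> y; apply: (@continuous_comp _ _ _ (fun y => (x, y)) f); last exact: cf.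
  exact: pair_continuousr.
by rewrite (segment_FTC (dw x) cg) per subee.
Qed.

End Square.

Section Slices.
Context {R : realType}.
Local Notation V := (R * 'rV[R]_2)%type.

Definition dir_t : V := (1, 0).
Definition dir (i : 'I_2) : V := (0, delta_mx 0 i).

Lemma point2E (p : R * R) : point2 p = p.1 *: delta_mx 0 0 + p.2 *: delta_mx 0 1.
Proof.
apply/rowP => i; rewrite !mxE eqxx /=.
by have [->|->] := ord2_case i; rewrite /= ?mulr1 ?mulr0 ?addr0 ?add0r.
Qed.

Lemma point2_continuous : continuous (@point2 R).
Proof.
have -> : @point2 R = (fun p => p.1 *: delta_mx 0 0 + p.2 *: delta_mx 0 1).
  by apply/funext => p; exact: point2E.
move=> p; apply: cvgD; apply: cvgZ; try exact: cvg_cst.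
  exact: cvg_fst.
exact: cvg_snd.
Qed.

Lemma derive_slice (W : normedModType R) (h : V -> W) t x w :
  'D_((0, w) : V) h (t, x) = 'D_w (fun x' => h (t, x')) x.
Proof.
rewrite /derive (_ : (fun s : R => _) =
  (fun s => s^-1 *: (((fun x' => h (t, x')) \o shift x) (s *: w) - h (t, x)))) //.
apply/funext => s /=; congr (_ *: (h _ - _)).
by apply/pair_equal_spec; split => //=; rewrite scaler0 add0r.
Qed.

Lemma lineE (y : R) (t s : R) :
  ((t, point2 (s, y)) : V) = s *: dir 0 + ((t, point2 (0, y)) : V).
Proof.
apply/pair_equal_spec; split => /=; first by rewrite scaler0 add0r.
by rewrite !point2E /= scale0r add0r.
Qed.

Lemma lineE1 (x : R) (t s : R) :
  ((t, point2 (x, s)) : V) = s *: dir 1 + ((t, point2 (x, 0)) : V).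
Proof.
apply/pair_equal_spec; split => /=; first by rewrite scaler0 add0r.
by rewrite !point2E /= scale0r addr0 addrC.
Qed.

End Slices.

(** * Differentiation under the integral sign *)

Section ConstantIntegral.
Context {R : realType}.
Local Notation V := (R * 'rV[R]_2)%type.

(** Joint continuity along the slice at [t0] becomes uniform over the unit square because the square
    is compact. *)
Lemma tube (J : set R) (h : V -> R) (t0 e : R) : 0 < e -> J t0 ->
  (forall x, h z @[z --> within [set z : V | J z.1] (nbhs ((t0, x) : V))]
     --> h (t0, x)) ->
  \forall t \near within J (nbhs t0), forall p, unit_square p ->
    `|h (t, point2 p) - h (t0, point2 p)| <= e.
Proof.
move=> e0 Jt0 ch.
have /compact_near_coveringP cov := @compact_unit_square R.
apply: (cov _ _ (fun t p => `|h (t, point2 p) - h (t0, point2 p)| <= e)) => p _.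
have e2 : 0 < e / 2 by rewrite divr_gt0.
have /cvgrPdist_lt/(_ _ e2) := ch (point2 p).
rewrite /within /= => -[[N1 N2] /= [n1 n2] N12].
exists (@point2 R @^-1` N2, N1 `&` J).
  split => /=; first exact: (@point2_continuous R p).
  by rewrite /within /=; apply: filterS n1 => t; split.
move=> [q t] /= [N2q [N1t Jt]].
have h1 := N12 (t, point2 q) (conj N1t N2q) Jt.
have h2 := N12 (t0, point2 q) (conj (nbhs_singleton n1) N2q) Jt0.
rewrite /= in h1 h2; rewrite -(subrKA (h (t0, point2 p))).
rewrite (le_trans (ler_normD _ _))// (splitr e) lerD// ltW//.
by rewrite distrC.
Qed.

Lemma slice_continuous (J : set R) (h : V -> R) (t : R) : J t ->
  (forall x, h z @[z --> within [set z : V | J z.1] (nbhs ((t, x) : V))]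
     --> h (t, x)) -> continuous (fun p => h (t, point2 p)).
Proof.
move=> Jt ch p; apply: cvg_trans (ch (point2 p)) => S hS.
have [[N1 N2] /= [n1 n2] N12] := hS.
have : nbhs p (@point2 R @^-1` N2) by exact: (@point2_continuous R p).
apply: filterS => q N2q /=.
exact: (N12 (t, point2 q) (conj (nbhs_singleton n1) N2q) Jt).
Qed.

Lemma cvg_withinW (S : set V) (h : V -> R) z : {for z, continuous h} ->
  h z' @[z' --> within S (nbhs z)] --> h z.
Proof. by move=> ch; apply: cvg_within_filter. Qed.

Lemma derivative_zero (A : R -> R) (t0 : R) :
  (forall e : R, 0 < e -> \forall t \near t0, `|A t - A t0| <= e * `|t - t0|) ->
  is_derive t0 1 A 0.
Proof.
move=> H.
have c : (fun h : R => h^-1 *: ((A \o shift t0) (h *: (1:R)) - A t0)) @ (0:R)^' --> (0 : R).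
  apply/cvgrPdist_le => e e0.
  have /nbhs0P/nbhs_dnbhs := H e e0.
  have : \forall h \near (0:R)^', h != 0 by exact: nbhs_dnbhs_neq.
  apply: filterS2 => h h0 /=.
  rewrite sub0r normrN (_ : h *: 1 = h); last by rewrite /GRing.scale /= mulr1.
  rewrite (addrC h t0) addrAC subrr add0r => Ah.
  by rewrite normrZ normfV mulrC ler_pdivrMr ?normr_gt0.
split; first by apply/cvg_ex; exists 0.
exact/cvg_lim.
Qed.

(** C^1 near each interior point. The condition is local, so each point may be treated in its own
    chart. *)
Definition regular (a b : R) (h : V -> R) := forall z : V, z.1 \in `]a, b[ ->
  exists U, [/\ open U, U z & differentiable_times 1 U h].

Section Family.
Variables (a b : R) (dens : V -> R) (W : 'I_2 -> V -> R).
Hypothesis ab : a < b.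
Let O (z : V) := z.1 \in `]a, b[.
Hypothesis dens_cont : forall t x, t \in `[a, b] ->
  dens z @[z --> within [set z : V | z.1 \in `[a, b]] (nbhs ((t, x) : V))]
    --> dens (t, x).
Hypothesis dens_reg : regular a b dens.
Hypothesis W_reg : forall i, regular a b (W i).
Hypothesis W_per : forall i z, O z -> W i (dir i + z) = W i z.
Hypothesis dens_div : forall z, O z ->
  'D_dir_t dens z = 'D_(dir 0) (W 0) z + 'D_(dir 1) (W 1) z.

Let regular_diff h z : regular a b h -> O z -> differentiable h z.
Proof. by move=> rh Oz; have [U [oU Uz [dU _]]] := rh z Oz; exact: dU. Qed.

Let regular_deriv h v t x : regular a b h -> t \in `]a, b[ ->
  'D_v h z @[z --> within [set z : V | z.1 \in `]a, b[] (nbhs ((t, x) : V))]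
    --> 'D_v h (t, x).
Proof.
move=> rh tab; have [U [oU Uz [_ cU]]] := rh (t, x) tab.
apply: cvg_withinW; exact: (cU v (t, x) Uz).
Qed.

Let area t := square_integral (fun p => dens (t, point2 p)).

Let deriv_cont h v t : regular a b h -> t \in `]a, b[ ->
  continuous (fun p => 'D_v h (t, point2 p)).
Proof.
move=> rh tab.
apply: (@slice_continuous [set t | t \in `]a, b[] ('D_v h)) => // x.
exact: regular_deriv.
Qed.

Let divergence_zero t : t \in `]a, b[ ->
  square_integral (fun p => 'D_dir_t dens (t, point2 p)) = 0.
Proof.
move=> tab.
pose d i p := 'D_(dir i) (W i) (t, point2 p).
have cd i : continuous (d i) := deriv_cont (v := dir i) (W_reg i) tab.
have Wd i z : z.1 \in `]a, b[ -> derivable (W i) z (dir i).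
  by move=> Oz; exact: (diff_derivable (regular_diff (W_reg i) Oz)).
have E0 : square_integral (d 0) = 0.
  have dw (x y : R) : is_derive x 1 (fun s => W 0 (t, point2 (s, y))) (d 0 (x, y)).
    have -> : (fun s => W 0 (t, point2 (s, y))) =
        (fun s => W 0 (s *: dir 0 + ((t, point2 (0, y)) : V))).
      by apply/funext => s; rewrite lineE.
    rewrite /d (lineE y t x); apply: (@is_derive_line _ _ (W 0) ((t, point2 (0, y)) : V) (dir 0) x).
    by apply: Wd; rewrite -lineE.
  apply: (square_integral_dx (w := fun p => W 0 (t, point2 p)) (cd 0) dw) => y /=.
  by rewrite (lineE y t 1) scale1r W_per.
have E1 : square_integral (d 1) = 0.
  have dw (x y : R) : is_derive y 1 (fun s => W 1 (t, point2 (x, s))) (d 1 (x, y)).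
    have -> : (fun s => W 1 (t, point2 (x, s))) =
        (fun s => W 1 (s *: dir 1 + ((t, point2 (x, 0)) : V))).
      by apply/funext => s; rewrite lineE1.
    rewrite /d (lineE1 x t y); apply: (@is_derive_line _ _ (W 1) ((t, point2 (x, 0)) : V) (dir 1) y).
    by apply: Wd; rewrite -lineE1.
  apply: (square_integral_dy (w := fun p => W 1 (t, point2 p)) (cd 1) dw) => x /=.
  by rewrite (lineE1 x t 1) scale1r W_per.
have -> : (fun p => 'D_dir_t dens (t, point2 p)) = (fun p => d 0 p + d 1 p).
  by apply/funext => p; exact: dens_div.
by rewrite (square_integralD (cd 0) (cd 1)) E0 E1 addr0.
Qed.

Let dens_slice t : t \in `[a, b] -> continuous (fun p => dens (t, point2 p)).
Proof.
move=> tab; apply: (@slice_continuous [set t | t \in `[a, b]] dens) => // x.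
exact: dens_cont.
Qed.

Let dens_line (x : 'rV[R]_2) (s t : R) : s <= t -> a < s -> t < b ->
  exists2 c, c \in `[s, t] &
    dens (t, x) - dens (s, x) = (t - s) * 'D_dir_t dens (c, x).
Proof.
move=> st as_ tb.
have E c : c *: dir_t + ((s, x) : V) = (c + s, x).
  by apply/pair_equal_spec; split => /=; rewrite ?scaler0 ?add0r // /GRing.scale /= mulr1.
have ts : 0 <= t - s by rewrite subr_ge0.
have [|c] := @MVT_line _ _ dens ((s, x) : V) dir_t (t - s) ts.
  move=> c; rewrite in_itv /= E => /andP[c0 ct]; apply: regular_diff => //.
  rewrite /O /= in_itv /=; lra.
rewrite !E subrK in_itv /= => /andP[c0 ct] Ed; exists (c + s) => //.
rewrite in_itv /=; lra.
Qed.

(** By the mean value theorem in t, the increment of the density differs from its linear part at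
    [t0] by at most [e * |t - t0|], uniformly over the square. *)
Let area_derive t0 : t0 \in `]a, b[ -> is_derive t0 1 area 0.
Proof.
move=> tab; apply: derivative_zero => e e0.
have d_cont x := regular_deriv (v := dir_t) (x := x) dens_reg tab.
have tubeH := @tube [set t | t \in `]a, b[] ('D_dir_t dens) t0 e e0 tab d_cont.
have nab : \forall t \near t0, t \in `]a, b[ by exact: near_in_itvoo.
have /nbhs_ballP[r /= r0 rP] : \forall t \near t0, (t \in `]a, b[) /\
    forall p, unit_square p ->
      `|'D_dir_t dens (t, point2 p) - 'D_dir_t dens (t0, point2 p)| <= e.
  by apply: filterS2 nab tubeH => t tab' H; split => //; exact: H.
apply/nbhs_ballP; exists r => // t tr.
have [t_ab _] := rP t tr.
pose f p := dens (t, point2 p) - dens (t0, point2 p).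
pose g p := (t - t0) * 'D_dir_t dens (t0, point2 p).
have cg0 : continuous (fun p => 'D_dir_t dens (t0, point2 p)) by exact: deriv_cont.
have cdt : continuous (fun p => dens (t, point2 p)).
  by apply: dens_slice; exact: subset_itv_oo_cc.
have cdt0 : continuous (fun p => dens (t0, point2 p)).
  by apply: dens_slice; exact: subset_itv_oo_cc.
have cf : continuous f by move=> p; apply: continuousB; [exact: cdt|exact: cdt0].
have cg : continuous g by move=> p; apply: cvgM; [exact: cvg_cst|exact: cg0].
have cfg : continuous (fun p => f p - g p).
  by move=> p; apply: continuousB; [exact: cf|exact: cg].
(* The linear part [g] can be subtracted at no cost: it is a multiple of a divergence and has
   integral 0. *)
have E : area t - area t0 = square_integral (fun p => f p - g p).
  rewrite (square_integralB cf cg) (square_integralB cdt cdt0).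
  by rewrite (square_integralZ _ cg0) divergence_zero // mulr0 subr0.
rewrite E; apply: (square_integral_le cfg) => p Qp.
have [c ctt0 fE] : exists2 c, `|c - t0| <= `|t - t0| &
    f p = (t - t0) * 'D_dir_t dens (c, point2 p).
  move: tab t_ab; rewrite !in_itv /= => /andP[a0 b0] /andP[a1 b1].
  have [tt0|t0t] := leP t0 t.
    have [c] := dens_line (point2 p) tt0 a0 b1.
    rewrite in_itv /= => /andP[c1 c2] Ec; exists c => //.
    by rewrite !ger0_norm ?subr_ge0 // lerD2r.
  have [c] := dens_line (point2 p) (ltW t0t) a1 b0.
  rewrite in_itv /= => /andP[c1 c2] Ec; exists c.
    rewrite (distrC c) (distrC t) !ger0_norm ?subr_ge0 ?lerD2l ?lerN2 //.
    exact: ltW.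
  by rewrite /f -opprB Ec -mulNr opprB.
rewrite fE /g -mulrBr normrM mulrC ler_wpM2r //.
have [_ H] : (c \in `]a, b[) /\ forall p, unit_square p ->
      `|'D_dir_t dens (c, point2 p) - 'D_dir_t dens (t0, point2 p)| <= e.
  apply: rP; rewrite /ball /= distrC; apply: le_lt_trans ctt0 _.
  by move: tr; rewrite /ball /= distrC.
exact: H.
Qed.

Let area_cont t0 : t0 \in `[a, b] ->
  area t @[t --> within `[a, b] (nbhs t0)] --> area t0.
Proof.
move=> tab; apply/cvgrPdist_le => e e0.
have d_cont x := @dens_cont t0 x tab.
have H := @tube [set t | t \in `[a, b]] dens t0 e e0 tab d_cont.
have wT : \forall t \near within [set t | t \in `[a, b]] (nbhs t0), t \in `[a, b].
  exact: withinT.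
apply: filterS2 wT H => t t_ab H.
have cdt := dens_slice t_ab; have cdt0 := dens_slice tab.
rewrite -(square_integralB cdt0 cdt); apply: square_integral_le.
  by move=> p; apply: continuousB; [exact: cdt0|exact: cdt].
by move=> p Qp; rewrite distrC; exact: H.
Qed.

(** The mean value theorem asks for the derivative only inside the interval and for continuity at
    its ends, where the time derivative of the density is not controlled. *)
Lemma constant_integral : area a = area b.
Proof.
have cA : {within `[a, b], continuous area}.
  by apply/subspace_continuousP => t /= tab; exact: area_cont.
have [c _] := MVT_segment (ltW ab) area_derive cA.
by rewrite mul0r => /eqP; rewrite subr_eq0 => /eqP.
Qed.

End Family.

End ConstantIntegral.

(** * Deformations through minimal surfaces *)

Section Deformation.
Context {R : realType} (a b : R) (f : R -> 'rV[R]_2 -> CP2 R).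
Local Notation V := (R * 'rV[R]_2)%type.
Let F (z : V) := f z.1 z.2.
Let A := [set z : V | z.1 \in `[a, b]].
Hypothesis imm : forall t, t \in `[a, b] -> immersed_torus (f t).
Hypothesis smF : smooth_map A F.

Definition rep_at (y z : V) := chart (chart_at (F y)) (F z).

(** The inner product of two velocities of the deformation. The chart varies with [y], so regularity
    is visible only after passing to a fixed chart. At the end times, a derivative with a time
    component would involve values of [f] outside the interval; only directions [(0, w)] are used
    there. *)
Definition gram v w y := fs (rep_at y y) ('D_v (rep_at y) y) ('D_w (rep_at y) y).

Lemma nbhs_slice (U : set V) t x : nbhs ((t, x) : V) U ->
  \forall x' \near x, U (t, x').
Proof.
move=> [[N1 N2] /= [n1 n2] N12]; apply: filterS n2 => x' N2x'.
exact: (N12 (t, x') (conj (nbhs_singleton n1) N2x')).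
Qed.

Lemma differentiable_slice (W : normedModType R) (g : V -> W) t x :
  differentiable g (t, x) -> differentiable (fun x' => g (t, x')) x.
Proof.
move=> dg; apply: (@differentiable_comp _ _ _ _ (fun x' => ((t, x') : V)) g) => //.
Qed.

Lemma slice_chart t x k : t \in `[a, b] -> in_chart k (f t x) ->
  (\forall x' \near x, in_chart k (f t x')) /\
  differentiable (fun x' => chart k (f t x')) x.
Proof.
move=> tI kx; have [U [g [Ux [oU Dg] Fg]]] := @smooth_map_chart _ _ A F (t, x) k smF tI kx.
have nU := nbhs_slice (open_nbhs_nbhs (conj oU Ux)); split.
  by apply: filterS nU => x' Ux'; have [] := Fg (t, x') tI Ux'.
apply: (@near_eq_differentiable _ _ _ (fun x' => g (t, x'))).
  by apply: filterS nU => x' Ux'; have [_ ->] := Fg (t, x') tI Ux'.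
apply: differentiable_slice; exact: (Dg 1%N).1.
Qed.

Lemma gram_spatial t x k w w' : t \in `[a, b] -> in_chart k (f t x) ->
  let u x' := chart k (f t x') in
  gram (0, w) (0, w') (t, x) = fs (u x) ('D_w u x) ('D_w' u x).
Proof.
move=> tI kx u; rewrite /gram !derive_slice.
have kx' := chart_atP (f t x).
have [n1 d1] := slice_chart tI kx; have [n2 d2] := slice_chart tI kx'.
exact: (fs_chart_independent w w' erefl erefl n2 d2 n1 d1).
Qed.

(** The smooth extension [g] agrees with the chart coordinates on whole slices, hence has the same
    spatial derivatives at every time of the closed interval. *)
Lemma gram_spatial_continuous t0 x0 w w' : t0 \in `[a, b] ->
  gram (0, w) (0, w') z @[z --> within A (nbhs ((t0, x0) : V))] -->
  gram (0, w) (0, w') (t0, x0).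
Proof.
move=> tI; have kx := chart_atP (f t0 x0).
have [U [g [Ux [oU Dg] Fg]]] := @smooth_map_chart _ _ A F (t0, x0) _ smF tI kx.
pose h z := fs (g z) ('D_((0, w) : V) g z) ('D_((0, w') : V) g z).
have E t x : t \in `[a, b] -> U (t, x) -> gram (0, w) (0, w') (t, x) = h (t, x).
  move=> t01 Utx; have [kx' ux] := Fg (t, x) t01 Utx.
  rewrite (gram_spatial w w' t01 kx') /h !derive_slice.
  have nE : \forall x' \near x, chart (chart_at (f t0 x0)) (f t x') = g (t, x').
    have nU := nbhs_slice (open_nbhs_nbhs (conj oU Utx)).
    by apply: filterS nU => y Uy; have [_ ->] := Fg (t, y) t01 Uy.
  by rewrite (near_eq_derive w nE) (near_eq_derive w' nE) -ux.
have ch : {for ((t0, x0) : V), continuous h}.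
  by apply: (differentiable_times_fs oU (Dg 0%N) ((Dg 1%N).2 _) ((Dg 1%N).2 _)).
rewrite E //; have cw := @cvg_withinW R A h _ ch.
have nE : \forall z \near within A (nbhs ((t0, x0) : V)), h z = gram (0, w) (0, w') z.
  rewrite /within /=; apply: filterS (open_nbhs_nbhs (conj oU Ux)) => -[t x] Utx At.
  by rewrite E.
exact: (cvg_trans (near_eq_cvg nE) cw).
Qed.

(** At interior times [A] is a neighbourhood, so the chart coordinates themselves, not just an
    extension of them, are smooth. *)
Lemma local_interior z k : z.1 \in `]a, b[ -> in_chart k (F z) ->
  exists U, [/\ open U, U z,
    forall y, U y -> (y.1 \in `]a, b[) /\ in_chart k (F y) &
    forall m, differentiable_times m U (fun y => chart k (F y))].
Proof.
move=> zI kz; have zA : A z by exact: subset_itv_oo_cc.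
have [U [g [Uz [oU Dg] Fg]]] := smooth_map_chart smF zA kz.
pose O := [set y : V | (y.1 \in `]a, b[)].
have oO : open O.
  apply: (@open_comp V R fst [set t | (t \in `]a, b[)]); last exact: interval_open.
  by move=> y _; exact: cvg_fst.
have oUO : open (U `&` O) by exact: openI.
have UOA y : (U `&` O) y -> A y by move=> [_ Oy]; exact: subset_itv_oo_cc.
exists (U `&` O); split => //.
- by move=> y UOy; case: (Fg y (UOA y UOy) UOy.1) => ky _; split => //; exact: UOy.2.
- move=> m; have Dm : differentiable_times m (U `&` O) g.
    by apply: differentiable_times_sub (Dg m) => y [].
  apply: differentiable_times_eq Dm => // y /set_mem UOy.
  by case: (Fg y (UOA y UOy) UOy.1).
Qed.

Lemma local_interior_near z k : z.1 \in `]a, b[ -> in_chart k (F z) ->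
  (\forall y \near z, in_chart k (F y)) /\
  differentiable (fun y => chart k (F y)) z.
Proof.
move=> zI kz; have [U [oU Uz Uk DU]] := local_interior zI kz; split.
  by apply: filterS (open_nbhs_nbhs (conj oU Uz)) => y /Uk[].
exact: (DU 1%N).1.
Qed.

Lemma gram_interior z k v w : z.1 \in `]a, b[ -> in_chart k (F z) ->
  let u y := chart k (F y) in gram v w z = fs (u z) ('D_v u z) ('D_w u z).
Proof.
move=> zI kz u; have kz' := chart_atP (F z).
have [n1 d1] := local_interior_near zI kz.
have [n2 d2] := local_interior_near zI kz'.
exact: (fs_chart_independent v w erefl erefl n2 d2 n1 d1).
Qed.

Lemma gram_regular v w : regular a b (gram v w).
Proof.
move=> z zI; have kz := chart_atP (F z).
have [U [oU Uz Uk DU]] := local_interior zI kz; exists U; split => //.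
pose u y := chart (chart_at (F z)) (F y).
have D : differentiable_times 1 U (fun y => fs (u y) ('D_v u y) ('D_w u y)).
  exact: (differentiable_times_fs oU (DU 1%N) ((DU 2).2 v) ((DU 2).2 w)).
have E : {in U, (fun y => fs (u y) ('D_v u y) ('D_w u y)) =1 gram v w}.
  by move=> y /set_mem /Uk[yI ky]; rewrite (gram_interior v w yI ky).
exact: (differentiable_times_eq oU E D).
Qed.

Lemma gram_sym v w z : gram v w z = gram w v z.
Proof. exact: fsC. Qed.

Lemma regularM h1 h2 : regular a b h1 -> regular a b h2 -> regular a b (fun z => h1 z * h2 z).
Proof.
move=> r1 r2 z zI; have [U1 [oU1 z1 D1]] := r1 z zI; have [U2 [oU2 z2 D2]] := r2 z zI.
have oU := openI oU1 oU2; exists (U1 `&` U2); split => //.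
by apply: differentiable_timesM => //;
  [apply: differentiable_times_sub D1|apply: differentiable_times_sub D2] => y [].
Qed.

Lemma regularB h1 h2 : regular a b h1 -> regular a b h2 -> regular a b (fun z => h1 z - h2 z).
Proof.
move=> r1 r2 z zI; have [U1 [oU1 z1 D1]] := r1 z zI; have [U2 [oU2 z2 D2]] := r2 z zI.
have oU := openI oU1 oU2; exists (U1 `&` U2); split => //.
by apply: differentiable_timesB => //;
  [apply: differentiable_times_sub D1|apply: differentiable_times_sub D2] => y [].
Qed.

(** [gramdet], [density] and [torus_flux] are the counterparts of [gram_det], [area_density] and
    [flux] built from [gram], hence defined without a fixed chart. *)
Definition gramdet v w z := gram v v z * gram w w z - gram v w z * gram v w z.
Definition density v w z := Num.sqrt (gramdet v w z).
Definition torus_flux v w z :=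
  (gram w w z * gram dir_t v z - gram v w z * gram dir_t w z) / density v w z.

(** Gram-Schmidt: the nonzero vector z = <x,x> y - <x,y> x has squared length <x,x> times the Gram
    determinant. *)
Lemma fs_gramdet_gt0 p (x y : 'rV[R]_4) :
  (forall c d : R, c *: x + d *: y = 0 -> c = 0 /\ d = 0) ->
  0 < fs p x x * fs p y y - fs p x y * fs p x y.
Proof.
move=> free; have E0 : 0 < fs p x x.
  apply: fs_gt0; apply/eqP => x0; have [] := free 1 0; last by move/eqP; rewrite oner_eq0.
  by rewrite x0 scale0r scaler0 addr0.
pose z := fs p x x *: y + (- fs p x y) *: x.
have z0 : z != 0.
  apply/eqP => zz; have [_ /eqP] := free (- fs p x y) (fs p x x) (etrans (addrC _ _) zz).
  by rewrite gt_eqF.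
have := fs_gt0 p z0.
rewrite /z fsDl !fsZl !(fsC p _ (_ + _)) !fsDl !fsZl (fsC p y x) => H.
rewrite -(pmulr_rgt0 _ E0).
by move: (fs p x x) (fs p x y) (fs p y y) H => e g h; lra.
Qed.

(** In ['I_2] the subtraction is modulo 2, so [1 - i] is the index other than [i]. *)
Lemma row_free_pair n (J : 'M[R]_(2, n)) i : row_free J -> forall c d : R,
  c *: row i J + d *: row (1 - i) J = 0 -> c = 0 /\ d = 0.
Proof.
move=> free c d cd0; pose r : 'rV[R]_2 := \row_j (if j == i then c else d).
have ri : (1 - i == i) = false by have [->|->] := ord2_case i.
have rJ : r *m J = 0.
  rewrite mulmx_sum_row sum_ord2 ![r 0 _]mxE -[RHS]cd0.
  have [->|->] := ord2_case i; first by rewrite subr0.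
  by rewrite subrr addrC.
have r0 : r = 0 by apply: (row_free_inj free); rewrite rJ mul0mx.
have rE j : r 0 j = 0 by rewrite r0 mxE.
split; first by have := rE i; rewrite mxE eqxx.
by have := rE (1 - i); rewrite mxE ri.
Qed.

Lemma gramdet_gt0 i z : z.1 \in `[a, b] -> 0 < gramdet (dir i) (dir (1 - i)) z.
Proof.
case: z => t x /= tI; have kx := chart_atP (f t x).
rewrite /gramdet !(gram_spatial _ _ tI kx) /=.
have [_ _ /(_ x) free] := imm tI.
pose u := local_rep (f t) x.
have Erow j : row j (jac u x) = 'D_(delta_mx 0 j) u x.
  by apply/rowP => a'; rewrite !mxE.
have H := row_free_pair (i := i) free.
have H' c d : c *: 'D_(delta_mx 0 i) u x + d *: 'D_(delta_mx 0 (1 - i)) u x = 0 ->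
    c = 0 /\ d = 0.
  by rewrite -(Erow i) -(Erow (1 - i)); exact: H.
exact: (fs_gramdet_gt0 _ H').
Qed.

Lemma density_regular i : regular a b (density (dir i) (dir (1 - i))).
Proof.
move=> z zI.
have rg : regular a b (gramdet (dir i) (dir (1 - i))).
  by apply: regularB; apply: regularM; exact: gram_regular.
have [U [oU Uz DU]] := rg z zI.
have [U' [oU' Uz' Uk _]] := local_interior zI (chart_atP (F z)).
have oUU := openI oU oU'; exists (U `&` U'); split => //.
apply: differentiable_times_sqrt => //.
  by move=> y [_ /Uk[yI _]]; apply: gramdet_gt0; exact: subset_itv_oo_cc.
by apply: differentiable_times_sub DU => y [].
Qed.

Lemma torus_flux_regular i : regular a b (torus_flux (dir i) (dir (1 - i))).
Proof.
move=> z zI.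
have rn : regular a b (fun z => gram (dir (1 - i)) (dir (1 - i)) z * gram dir_t (dir i) z -
    gram (dir i) (dir (1 - i)) z * gram dir_t (dir (1 - i)) z).
  by apply: regularB; apply: regularM; exact: gram_regular.
have [U [oU Uz DU]] := rn z zI.
have [U1 [oU1 Uz1 DU1]] := density_regular i zI.
have [U' [oU' Uz' Uk _]] := local_interior zI (chart_atP (F z)).
have oUU := openI oU (openI oU1 oU'); exists (U `&` (U1 `&` U')); split => //.
apply: differentiable_timesM => //.
  by apply: differentiable_times_sub DU => y [].
apply: differentiable_timesV => //.
  move=> y [_ [_ /Uk[yI _]]]; rewrite gt_eqF // sqrtr_gt0.
  by apply: gramdet_gt0; exact: subset_itv_oo_cc.
by apply: differentiable_times_sub DU1 => y [_ []].
Qed.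

Lemma fs_congr (p p' v v' w w' : 'rV[R]_4) :
  p = p' -> v = v' -> w = w' -> fs p v w = fs p' v' w'.
Proof. by move=> -> -> ->. Qed.

(** Translation by a lattice vector does not change the point of CP^2, so the same chart is selected
    at both places and the two coordinate maps agree near [z]. *)
Lemma gram_periodic i v w z : z.1 \in `]a, b[ -> gram v w (dir i + z) = gram v w z.
Proof.
move=> zI.
have FE y : y.1 \in `[a, b] -> F (dir i + y) = F y.
  move=> yI; have [per _ _] := imm yI; rewrite /F /= add0r; apply/esym/per.
  exists (delta_mx 0 i); rewrite addrC; congr (_ + _).
  by apply/rowP => j; rewrite !mxE; case: (_ && _).
have zA : z.1 \in `[a, b] by exact: subset_itv_oo_cc.
have [U [oU Uz Uk _]] := local_interior zI (chart_atP (F z)).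
have nE : \forall y \near z, rep_at (dir i + z) (dir i + y) = rep_at z y.
  apply: filterS (open_nbhs_nbhs (conj oU Uz)) => y /Uk[yI _].
  by rewrite /rep_at !FE //; exact: subset_itv_oo_cc.
have D t : 'D_t (rep_at (dir i + z)) (dir i + z) = 'D_t (rep_at z) z.
  rewrite -(near_eq_derive t nE).
  exact: esym (derive_translate (rep_at (dir i + z)) (dir i) z t).
exact: (fs_congr (nbhs_singleton nE) (D v) (D w)).
Qed.

Lemma torus_flux_periodic i j k z : z.1 \in `]a, b[ ->
  torus_flux (dir j) (dir k) (dir i + z) = torus_flux (dir j) (dir k) z.
Proof. by move=> zI; rewrite /torus_flux /density /gramdet !gram_periodic. Qed.

End Deformation.

Lemma pullback_inner {R : realType} {m n : nat} (B : 'rV[R]_n -> 'M[R]_n)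
    (u : 'rV[R]_m -> 'rV[R]_n) x i j :
  pullback B u x i j = inner B (u x) (row i (jac u x)) (row j (jac u x)).
Proof.
rewrite innerE /pullback -row_mul tr_row.
by rewrite mxE [RHS]mxE; apply: eq_bigr => c _; congr (_ * _); rewrite !mxE.
Qed.

(** * Minimality of the slices, seen in space-time *)

Section MinimalSlice.
Context {R : realType} {n : nat} (G : 'rV[R]_n -> 'M[R]_n).
Local Notation V := (R * 'rV[R]_2)%type.
Hypothesis Gsym : forall p a b, G p a b = G p b a.
Context (u : V -> 'rV[R]_n) (X : V -> V -> 'rV[R]_n) (X2 : V -> V -> V -> 'rV[R]_n).
Hypothesis XE : forall v y, 'D_v u y = X v y.
Hypothesis X2E : forall t v y, 'D_t (X v) y = X2 t v y.

Lemma row_jac_slice t x i :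
  row i (jac (fun x' => u (t, x')) x) = X (dir i) (t, x).
Proof. by apply/rowP => c; rewrite -XE derive_slice !mxE. Qed.

Lemma covd_slice t x i j :
  covd G (fun x' => u (t, x')) i j x =
  connection G (u (t, x)) (X (dir i) (t, x)) (X (dir j) (t, x)) (X2 (dir i) (dir j) (t, x)).
Proof.
rewrite -!row_jac_slice -X2E derive_slice.
have -> : (fun x' => X (dir j) (t, x')) = pd j (fun x' => u (t, x')).
  by apply/funext => x'; rewrite -XE derive_slice.
apply/rowP => c; rewrite mxE [RHS]mxE; congr (_ + _).
by apply: eq_bigr => a _; apply: eq_bigr => b _; rewrite ![row _ _ _ _]mxE.
Qed.

Lemma pullback_slice t x i j :
  pullback G (fun x' => u (t, x')) x i j =
  inner G (u (t, x)) (X (dir i) (t, x)) (X (dir j) (t, x)).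
Proof.
by rewrite pullback_inner !row_jac_slice.
Qed.

(** [mean_curvature_eq0] for the slice at time [t], tested against the velocity in direction [v0]
    and put in the form that [first_variation] asks for. *)
Lemma minimal_slice t x v0 (z : V := (t, x)) :
  let B i j := connection G (u z) (X (dir i) z) (X (dir j) z) (X2 (dir i) (dir j) z) in
  let g v w := inner G (u z) (X v z) (X w z) in
  let ip Z v := inner G (u z) Z (X v z) in
  let H v := g (dir 1) (dir 1) * ip (B 0 0) v - 2 * g (dir 0) (dir 1) * ip (B 0 1) v
             + g (dir 0) (dir 0) * ip (B 1 1) v in
  0 < gram_det G u X (dir 0) (dir 1) z -> B 1 0 = B 0 1 ->
  mean_curvature G (fun x' => u (t, x')) x = 0 ->
  gram_det G u X (dir 0) (dir 1) z * H v0 =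
    H (dir 0) * (g (dir 1) (dir 1) * g v0 (dir 0) - g (dir 0) (dir 1) * g v0 (dir 1)) +
    H (dir 1) * (g (dir 0) (dir 0) * g v0 (dir 1) - g (dir 0) (dir 1) * g v0 (dir 0)).
Proof.
move=> B g ip H d0 Bsym mc.
have gs v w : g v w = g w v by exact: inner_sym.
have dE : \det (pullback G (fun x' => u (t, x')) x) = gram_det G u X (dir 0) (dir 1) z.
  rewrite det_mx2 !pullback_slice /gram_det; congr (_ - _ * _); exact: gs.
have := @mean_curvature_eq0 _ _ G (fun x' => u (t, x')) x (X v0 z).
rewrite /= dE !pullback_slice !row_jac_slice !covd_slice gt_eqF // => /(_ isT mc).
rewrite -/z -/(B 0 0) -/(B 0 1) -/(B 1 0) -/(B 1 1) Bsym.
rewrite -/(g (dir 0) (dir 0)) -/(g (dir 0) (dir 1)) -/(g (dir 1) (dir 0)) -/(g (dir 1) (dir 1)).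
rewrite -/(g (dir 0) v0) -/(g (dir 1) v0) (gs (dir 0) v0) (gs (dir 1) v0) (gs (dir 1) (dir 0)).
rewrite /H /ip; move=> E; move: E.
move: (gram_det _ _ _ _ _ _) (g _ _) (g _ _) (g _ _) (g _ _) (g _ _) => D.
by move=> *; lra.
Qed.

End MinimalSlice.

Section FubiniStudyMetric.
Context {R : realType} (k : 'I_3).

Lemma fubini_study_sym (p : 'rV[R]_4) a b : fubini_study k p a b = fubini_study k p b a.
Proof. by rewrite !fubini_studyE fsC. Qed.

Lemma fubini_study_unit (p : 'rV[R]_4) : fubini_study k p \in unitmx.
Proof.
rewrite -row_free_unit; apply: inj_row_free => v vG.
apply/eqP; apply: contraT => v0; have := fs_gt0 p v0.
by rewrite -(inner_fubini_study k) innerE vG mul0mx mxE ltxx.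
Qed.

Lemma fubini_study_differentiable (p : 'rV[R]_4) a b :
  differentiable (fun q => fubini_study k q a b) p.
Proof.
have E q : fs q (delta_mx 0 a) (delta_mx 0 b) = fubini_study k q a b.
  by rewrite fubini_studyE.
have idT := @differentiable_times_id R _ 1 [set: 'rV[R]_4].
have cstT c := @differentiable_times_cst R _ _ 1 [set: 'rV[R]_4] (delta_mx 0 c : 'rV[R]_4).
have D := differentiable_times_fs openT idT (cstT a) (cstT b).
have nE : \forall q \near p, fs q (delta_mx 0 a) (delta_mx 0 b) = fubini_study k q a b.
  by apply: filterS (@filterT _ (nbhs p) _) => q _; exact: E.
exact: (near_eq_differentiable nE (D.1 p I)).
Qed.

End FubiniStudyMetric.

Section DensityDivergence.
Context {R : realType} (a b : R) (f : R -> 'rV[R]_2 -> CP2 R).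
Local Notation V := (R * 'rV[R]_2)%type.
Let F (z : V) := f z.1 z.2.
Hypothesis imm : forall t, t \in `[a, b] -> immersed_torus (f t).
Hypothesis min : forall t, t \in `[a, b] -> minimal (f t).
Hypothesis smF : smooth_map [set z : V | z.1 \in `[a, b]] F.

(** [first_variation] is applied in the chart selected at [F z], the one in which minimality at [z]
    is stated, and is then transferred to the quantities defined without a fixed chart. *)
Lemma density_divergence (z : V) : z.1 \in `]a, b[ ->
  'D_dir_t (density f (dir 0) (dir 1)) z =
  'D_(dir 0) (torus_flux f (dir 0) (dir 1)) z + 'D_(dir 1) (torus_flux f (dir 1) (dir 0)) z.
Proof.
case: z => t x tI; set z : V := (t, x).
have tI' : t \in `[a, b] by exact: subset_itv_oo_cc.
have kz := chart_atP (F z).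
have [U [oU Uz Uk DU]] := local_interior smF tI kz.
pose k := chart_at (F z); pose u (y : V) := chart k (F y).
have [X XE] : exists X : V -> V -> 'rV[R]_4, forall v y, 'D_v u y = X v y.
  by exists (fun v y => 'D_v u y).
have [X2 X2E] : exists X2 : V -> V -> V -> 'rV[R]_4, forall w v y, 'D_w (X v) y = X2 w v y.
  by exists (fun w v y => 'D_w (X v) y).
pose G := @fubini_study R k.
have gE v w y : U y -> inner G (u y) (X v y) (X w y) = gram f v w y.
  move=> /Uk[yI ky]; rewrite inner_fubini_study -!XE.
  exact: esym (gram_interior smF v w yI ky).
have detE v w y : U y -> gram_det G u X v w y = gramdet f v w y.
  by move=> Uy; rewrite /gram_det (gE v v) // (gE w w) // (gE v w).
have denE v w y : U y -> area_density G u X v w y = density f v w y.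
  by move=> Uy; rewrite /area_density detE.
have fluxE v w y : U y -> flux G u X dir_t v w y = torus_flux f v w y.
  move=> Uy; rewrite /flux (gE w w) // (gE dir_t v) // (gE v w) // (gE dir_t w) //.
  by rewrite denE.
have nU := open_nbhs_nbhs (conj oU Uz).
have D0 : 0 < gram_det G u X (dir 0) (dir 1) z.
  by rewrite detE //; have := gramdet_gt0 imm smF 0 (z := z) tI'; rewrite subr0.
have Bsym := connection_torsion_free (@fubini_study_sym R k) oU (DU 2)
  XE X2E (dir 1) (dir 0) Uz.
have Hmin := minimal_slice (@fubini_study_sym R k) XE X2E dir_t D0 Bsym (min tI' x).
have fv := first_variation (@fubini_study_sym R k) (@fubini_study_unit R k)
  (@fubini_study_differentiable R k) oU (DU 2)
  XE X2E Uz D0 Hmin.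
(* Equality at [z] alone would not suffice: the quantities agree on a neighbourhood, by chart
   independence, so their derivatives agree too. *)
have n1 : \forall y \near z, area_density G u X (dir 0) (dir 1) y = density f (dir 0) (dir 1) y.
  by apply: filterS nU; exact: denE.
have n2 v w : \forall y \near z, flux G u X dir_t v w y = torus_flux f v w y.
  by apply: filterS nU; exact: fluxE.
have e1 := near_eq_derive dir_t n1.
have e2 := near_eq_derive (dir 0) (n2 (dir 0) (dir 1)).
have e3 := near_eq_derive (dir 1) (n2 (dir 1) (dir 0)).
exact: (etrans (esym e1) (etrans fv (congr2 +%R e2 e3))).
Qed.

End DensityDivergence.

(** * Constancy of the area *)

Section AreaOfDeformation.
Context {R : realType}.
Local Notation V := (R * 'rV[R]_2)%type.

Lemma induced_metricE (a b : R) (f : R -> 'rV[R]_2 -> CP2 R)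
    (smF : smooth_map [set z : V | z.1 \in `[a, b]] (fun z => f z.1 z.2)) t x i j :
  t \in `[a, b] -> induced_metric (f t) x i j = gram f (dir i) (dir j) (t, x).
Proof.
move=> tI; have kx := chart_atP (f t x); pose u := local_rep (f t) x.
have rowE l : row l (jac u x) = 'D_(delta_mx 0 l) u x.
  by apply/rowP => c; rewrite !mxE.
have e1 : induced_metric (f t) x i j = fs (u x) (row i (jac u x)) (row j (jac u x)).
  by rewrite -(inner_fubini_study (chart_at (f t x))) -pullback_inner.
have e2 := gram_spatial smF (delta_mx 0 i) (delta_mx 0 j) tI kx.
exact: (etrans e1 (etrans (fs_congr erefl (rowE i) (rowE j)) (esym e2))).
Qed.

Lemma area_density_eq (a b : R) (f : R -> 'rV[R]_2 -> CP2 R)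
    (smF : smooth_map [set z : V | z.1 \in `[a, b]] (fun z => f z.1 z.2)) t x :
  t \in `[a, b] ->
  Num.sqrt (\det (induced_metric (f t) x)) = density f (dir 0) (dir 1) (t, x).
Proof.
move=> tI; have e i j := induced_metricE smF x i j tI.
by rewrite det_mx2 (e 0 0) (e 0 1) (e 1 0) (e 1 1) (gram_sym f (dir 1) (dir 0)).
Qed.

Lemma area_constant (a b : R) (f : R -> 'rV[R]_2 -> CP2 R) : a < b ->
  (forall t, t \in `[a, b] -> immersed_torus (f t)) ->
  (forall t, t \in `[a, b] -> minimal (f t)) ->
  smooth_map [set z : V | z.1 \in `[a, b]] (fun z => f z.1 z.2) ->
  area (f a) = area (f b).
Proof.
move=> ab imm min smF.
pose W (i : 'I_2) := torus_flux f (dir i) (dir (1 - i)).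
have W0 : W 0 = torus_flux f (dir 0) (dir 1) :=
  congr1 (fun j : 'I_2 => torus_flux f (dir 0) (dir j)) (subr0 1).
have W1 : W 1 = torus_flux f (dir 1) (dir 0) :=
  congr1 (fun j : 'I_2 => torus_flux f (dir 1) (dir j)) (subrr 1).
have dreg : regular a b (density f (dir 0) (dir 1)).
  by have := density_regular imm smF 0; rewrite (subr0 1).
have Wreg i : regular a b (W i) by exact: torus_flux_regular.
have Wper i z : z.1 \in `]a, b[ -> W i (dir i + z) = W i z.
  exact: (torus_flux_periodic imm smF).
have dcont t x : t \in `[a, b] ->
    density f (dir 0) (dir 1) z @[z --> within [set z : V | z.1 \in `[a, b]] (nbhs ((t, x) : V))]
    --> density f (dir 0) (dir 1) (t, x).
  move=> tI.
  have cg (i j : 'I_2) := gram_spatial_continuous smF (x0 := x) (w := delta_mx 0 i)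
    (w' := delta_mx 0 j) tI.
  have cdet : gramdet f (dir 0) (dir 1) z
      @[z --> within [set z : V | z.1 \in `[a, b]] (nbhs ((t, x) : V))]
      --> gramdet f (dir 0) (dir 1) (t, x).
    by apply: cvgB; apply: cvgM; exact: cg.
  exact: (cvg_comp _ _ cdet (@sqrt_continuous R _)).
have ddiv z : z.1 \in `]a, b[ -> 'D_dir_t (density f (dir 0) (dir 1)) z =
    'D_(dir 0) (W 0) z + 'D_(dir 1) (W 1) z.
  by move=> zI; rewrite W0 W1; exact: (density_divergence imm min smF zI).
have E := constant_integral ab dcont dreg Wreg Wper ddiv.
have aE t : t \in `[a, b] ->
    area (f t) = (square_integral (fun p => density f (dir 0) (dir 1) (t, point2 p)))%:E.
  move=> tI; rewrite -square_integralE.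
    by apply: eq_integral => p _; rewrite (area_density_eq smF).
  exact: (@slice_continuous R [set t | t \in `[a, b]] (density f (dir 0) (dir 1)) t tI
    (fun x => dcont t x tI)).
have aI : a \in `[a, b] by rewrite in_itv /= lexx ltW.
have bI : b \in `[a, b] by rewrite in_itv /= lexx ltW.
exact: (etrans (aE a aI) (etrans (congr1 EFin E) (esym (aE b bI)))).
Qed.

End AreaOfDeformation.

Theorem theorem1 (R : realType) (I : interval R)
    (Sigma0 : 'rV[R]_2 -> CP2 R) (Sigma : R -> 'rV[R]_2 -> CP2 R)
    (hmin0 : minimal_lagrangian_torus Sigma0)
    (hdef : smooth_deformation I Sigma0 Sigma)
    (hconf : preserves_conformal_type I Sigma0 Sigma)
    (hmin : forall t : R, t \in I -> minimal_lagrangian_torus (Sigma t)) :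
  forall t : R, t \in I -> area (Sigma t) = area Sigma0.
Proof.
case: hdef => I0 <- imm sm t It.
(* [I] may be open, closed or unbounded; any two of its times span a compact subinterval, to which
   the deformation is restricted. *)
have H a b : a < b -> a \in I -> b \in I -> area (Sigma a) = area (Sigma b).
  move=> ab aI bI.
  have sub s : s \in `[a, b] -> s \in I.
    by rewrite in_itv /= => /andP[as_ sb]; apply: (interval_is_interval aI bI); rewrite as_.
  apply: (@area_constant _ _ _ Sigma ab).
  - by move=> s /sub; exact: imm.
  - by move=> s /sub /hmin[].
  - move=> z /= /sub zI; have [k [U [g [Uz sg Ug]]]] := sm z zI.
    by exists k, U, g; split => // y /sub yI; exact: Ug.
have [t0|t0|->//] := ltgtP t 0; last exact/esym/H.
exact: H.
Qed.
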